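(* (i) Let $(a,b,c)$ be any Markov triple, let $p_1,p_2$ be integers satisfying $$p_2 b - p_1 a = c,$$ and let $$x=\frac{p_2}{a}+\frac{b}{ac}-\frac{3}{2}+\sqrt{\frac{9}{4}-\frac{1}{c^2}}\,.$$ Then there are infinitely many fractions $\frac{p}{q}$ satisfying $$\Big|x-\frac{p}{q}\Big|<\frac{1}{\lambda q^2}\quad\text{with}\quad \lambda=\sqrt{9-\frac{4}{c^2}},$$ but only finitely many for any larger value of $\lambda$. (ii) Conversely, suppose $x'$ is an irrational number such that for some $\lambda<3$ (with $\lambda>0$) only finitely many fractions $\frac{p}{q}$ satisfy $\big|x'-\frac{p}{q}\big|<\frac{1}{\lambda q^2}$. Then there exists a unique sorted Markov triple $(a,b,c)$ such that $x'$ is equivalent to the number $$x=\frac{p_2}{a}+\frac{b}{ac}-\frac{3}{2}+\sqrt{\frac{9}{4}-\frac{1}{c^2}},$$ where $p_1,p_2$ are integers with $p_2b-p_1a=c$.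
   Context: A Markov triple is a triple $(a,b,c)$ of positive integers satisfying Markov's equation $a^2+b^2+c^2=3abc$. A sorted Markov triple is a Markov triple with $a\le b\le c$. The three integers of a Markov triple are pairwise coprime, so integers $p_1,p_2$ with $p_2b-p_1a=c$ always exist; different choices of $(p_1,p_2)$ for the same Markov triple give values of $x$ differing by integers. Two real numbers $x,x'$ are called equivalent if $x'=\frac{\alpha x+\beta}{\gamma x+\delta}$ for some integers $\alpha,\beta,\gamma,\delta$ with $|\alpha\delta-\beta\gamma|=1$. Fractions $\frac pq$ have integer numerator $p$ and positive integer denominator $q$. *)

(* Defs.v *)
From mathcomp Require Import all_boot all_order all_algebra.
From mathcomp Require Import all_classical all_reals.

Set Implicit Arguments.
Unset Strict Implicit.
Unset Printing Implicit Defensive.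

Import Order.TTheory GRing.Theory Num.Theory.
Local Open Scope ring_scope.

Definition markov_triple (a b c : nat) : Prop :=
  [/\ (0 < a)%N, (0 < b)%N, (0 < c)%N
    & (a ^ 2 + b ^ 2 + c ^ 2 = 3 * a * b * c)%N].

Definition sorted_markov_triple (a b c : nat) : Prop :=
  markov_triple a b c /\ (a <= b <= c)%N.

Definition markov_bezout (a b c : nat) (p1 p2 : int) : Prop :=
  p2 * b%:Z - p1 * a%:Z = c%:Z.

(* p1 does not occur in the formula: it is determined by p2. *)
Definition markov_irrational (R : realType) (a b c : nat) (p2 : int) : R :=
  p2%:~R / a%:R + b%:R / (a%:R * c%:R) - 3 / 2
  + Num.sqrt (9 / 4 - 1 / c%:R ^+ 2).

(* A fraction p / q is encoded as the pair (p, q), not necessarily in lowest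
   terms. For irrational x, whether the set below is finite does not depend on
   whether reduced or arbitrary fractions are counted. *)
Definition good_fractions (R : realType) (x lambda : R) : set (int * nat) :=
  [set pq | (0 < pq.2)%N /\
     `|x - pq.1%:~R / pq.2%:R| < 1 / (lambda * pq.2%:R ^+ 2)].

(* The condition on the denominator excludes the convention y / 0 = 0; it holds
   automatically when x is irrational. *)
Definition equivalent_reals (R : realType) (x x' : R) : Prop :=
  exists alpha beta gamma delta : int,
    [/\ `|alpha * delta - beta * gamma| = 1,
        gamma%:~R * x + delta%:~R != 0
      & x' = (alpha%:~R * x + beta%:~R) / (gamma%:~R * x + delta%:~R)].

(* Main.v *)
Require Import Defs.
From mathcomp Require Import all_boot all_order all_algebra.
From mathcomp Require Import all_classical all_reals.
From mathcomp Require Import zify ring lra.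

Set Implicit Arguments.
Unset Strict Implicit.
Unset Printing Implicit Defensive.

Import Order.TTheory GRing.Theory Num.Theory.
Local Open Scope ring_scope.

(** The proof is an algebraic version of Springborn's argument with ideal
    triangulations of the modular torus.  A fraction p/q is the vector (p, q);
    a Markov triple (a, b, c) is realised by vectors v1, v2, v3 with
    a v1 + b v2 + c v3 = 0 whose pairwise determinants are c, a, b, and the
    triangle beyond the edge v1 v2 has the third vertex (b v1 - a v2) / c.

    Part (i): the form F with roots x and its conjugate takes the values c and
    -c along the two sides of a strip of triangles, and it grows across every
    edge leading out of the strip.  So the minimum of |F| is c, attained only on
    the boundary of the strip; the minimal vectors also determine the triple.

    Part (ii): write y(p, q) = q x' - p.  If |q y| >= mu > 1/3 at both ends of an
    edge of label c crossed on the way to x', then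
    y1^2 + y2^2 < 3 c y1 y2, because c = |q1| y2 + |q2| y1.  The left-hand side
    minus the right-hand side is invariant under translation along the strip
    bounded by that edge, so the path cannot leave the strip on the side where it
    entered.  Hence the cutting sequence either alternates between two letters
    eventually, and x' is the end of a closed geodesic, or some letter occurs at
    every other place.  In the latter case flipping the corresponding edge gives
    a larger triple with the same property; this stops because cutting off the
    corner opposite to an edge of maximal label M infinitely often forces
    9 - 4/M^2 <= lambda^2 < 9. *)

(** * Markov triples and quadratic forms along an edge *)

Definition markovz (a b c : int) : Prop :=
  [/\ 0 < a, 0 < b, 0 < c & a ^+ 2 + b ^+ 2 + c ^+ 2 = 3 * a * b * c].

Lemma markovz_rot a b c : markovz a b c -> markovz b c a.
Proof. by case=> a0 b0 c0 h; split=> //; lia. Qed.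

Lemma markovz_swap a b c : markovz a b c -> markovz b a c.
Proof. by case=> a0 b0 c0 h; split=> //; lia. Qed.

(** [c] and [3 * a * b - c] are the roots of t^2 - 3 a b t + a^2 + b^2; their product is positive,
    hence so is the second root. *)
Lemma markovz_mut a b c : markovz a b c -> markovz a b (3 * a * b - c).
Proof. by case=> a0 b0 c0 h; split=> //; nia. Qed.

(** Descent in the Markov tree: the quadratic with roots [c] and [3 * a * b - c] is nonpositive at
    max(a, b), which therefore separates the two roots. *)
Lemma markovz_max a b c : markovz a b c -> a <= c -> b <= c -> 1 < c ->
  [/\ a < c, b < c & 3 * a * b - c < c].
Proof.
move=> [a0 b0 c0 h] ac bc c1.
have ltac (x y : int) : 0 < x -> 0 < y -> y <= c ->
    x ^+ 2 + y ^+ 2 + c ^+ 2 = 3 * x * y * c -> x <= c -> x < c.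
  move=> x0 y0 yc e xc; rewrite lt_neqAle xc andbT; apply/eqP => xE.
  (* If x = c, then y <= c forces 3 y - 2 = 1, hence y = 1 and c = 1, against 1 < c. *)
  have : y ^+ 2 = c ^+ 2 * (3 * y - 2) by rewrite xE in e; nia.
  by nia.
have ac' : a < c by apply: (ltac a b).
have bc' : b < c by apply: (ltac b a) => //; lia.
split=> //.
have [ab|ba] := leP a b.
  suff : 3 * a * b - c <= b by lia.
  have : (c - b) * (3 * a * b - c - b) <= 0 by nia.
  by nia.
suff : 3 * a * b - c <= a by lia.
have : (c - a) * (3 * a * b - c - a) <= 0 by nia.
by nia.
Qed.

(** Every triple descends to (1, 1, 1): a rotation brings the largest entry to the last place, and
    mutating it lowers the sum of the entries. *)
Lemma markovz_ind (P : int -> int -> int -> Prop) :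
  (forall a b c, P a b c -> P b c a) ->
  (forall a b c, markovz a b c -> P a b (3 * a * b - c) -> P a b c) ->
  P 1 1 1 -> forall a b c, markovz a b c -> P a b c.
Proof.
move=> Prot Pmut P1 a b c mk.
have [n] := ubnP (absz (a + b + c)); elim: n => // n IH in a b c mk *.
have step (x y z : int) : markovz x y z -> x <= z -> y <= z ->
    (absz (x + y + z)%R < n.+1)%N -> P x y z.
  move=> mk' xz yz lt; have [x0 y0 z0 e] := mk'.
  have [z1|z1] := leP z 1.
    have -> : x = 1 by lia.
    have -> : y = 1 by lia.
    have -> : z = 1 by lia.
    by [].
  have [_ _ zz] := markovz_max mk' xz yz z1.
  have mk2 := markovz_mut mk'; have [_ _ z'0 _] := mk2.
  by apply: Pmut => //; apply: IH => //; lia.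
move=> lt; have mk1 := markovz_rot mk; have mk2 := markovz_rot mk1.
have [ac|ca] := leP a c; have [bc|cb] := leP b c.
- exact: step.
- by apply/Prot; apply: step; rewrite // ?(ltW cb) //; lia.
- apply/Prot; apply/Prot; apply: step; first exact: mk1.
 lia. lia. lia.
- have [ab|ba] := leP a b; [apply/Prot | apply/Prot; apply/Prot].
    by apply: step => //; lia.
  by apply: step => //; lia.
Qed.

Lemma markovz_coprime a b c : markovz a b c -> coprimez a b.
Proof.
pose P x y z := [/\ coprimez x y, coprimez y z & coprimez z x].
suff PP : markovz a b c -> P a b c by case/PP.
apply: (markovz_ind (P := P)) => {a b c}; rewrite /P ?coprimezz //.
  by move=> a b c [? ? ?].
move=> a b c _ [ab bc ca]; split=> //.
  have -> : c = 3 * a * b + - (3 * a * b - c) by ring.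
  by rewrite /coprimez gcdzMDl gcdzN.
have -> : c = 3 * b * a + - (3 * a * b - c) by ring.
by rewrite coprimez_sym /coprimez gcdzMDl gcdzN gcdzC.
Qed.

(** Modulo [c], a^2 + b^2 vanishes and [a] is invertible, so b x - a y is b/a times a x + b y. *)
Lemma markovz_dvd a b c x y : markovz a b c ->
  (c %| a * x + b * y)%Z -> (c %| b * x - a * y)%Z.
Proof.
move=> mk; have [_ _ _ e] := mk => h.
rewrite -(Gauss_dvdzr _ (markovz_coprime (markovz_rot (markovz_rot mk)))).
have -> : a * (b * x - a * y) = b * (a * x + b * y) - (a ^+ 2 + b ^+ 2) * y by ring.
apply: rpredB; first exact: dvdz_mull.
have -> : a ^+ 2 + b ^+ 2 = c * (3 * a * b - c) by lia.
by apply: dvdz_mulr; apply: dvdz_mulr.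
Qed.

Lemma vec_eq (u v : int * int) : u.1 = v.1 -> u.2 = v.2 -> u = v.
Proof. by case: u v => [? ?] [? ?] /= -> ->. Qed.

Definition vdet (u v : int * int) : int := u.1 * v.2 - u.2 * v.1.

Definition qform (A N L : int) (v : int * int) : int :=
  A * v.1 ^+ 2 + N * v.1 * v.2 + L * v.2 ^+ 2.

(** The polar form: Q(s u + t u') = s^2 Q(u) + t^2 Q(u') + s t B(u, u'). *)
Definition bform (A N L : int) (u v : int * int) : int :=
  2 * A * u.1 * v.1 + N * (u.1 * v.2 + u.2 * v.1) + 2 * L * u.2 * v.2.

(** For a Markov triple (a, b, e) this makes the apex (b u + a u') / e integral, by
    [markovz_dvdN]. *)
Definition edge_cong (e a b : int) (u u' : int * int) : bool :=
  (e %| a * u.1 - b * u'.1)%Z && (e %| a * u.2 - b * u'.2)%Z.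

Lemma markovz_dvdN a b c x y : markovz a b c ->
  (c %| a * x - b * y)%Z -> (c %| b * x + a * y)%Z.
Proof.
move=> mk h; have := @markovz_dvd _ _ _ x (- y) mk.
by rewrite mulrN => /(_ h); rewrite mulrN opprK.
Qed.

(** While [e] is not the largest entry, the larger of [a], [b] is mutated with [e] fixed, which
    lowers a + b. The new congruence is, modulo [e] and up to sign, the divisibility of b u + a
    u'. *)
Lemma edge_cong_max e a b u u' : markovz a b e -> edge_cong e a b u u' ->
  exists a' b', [/\ markovz a' b' e, edge_cong e a' b' u u', a' <= e & b' <= e].
Proof.
have [n] := ubnP (absz (a + b)); elim: n => // n IH in a b *.
move=> lt mk /andP[h1 h2]; have [a0 b0 e0 E] := mk.
have k1 := markovz_dvdN mk h1; have k2 := markovz_dvdN mk h2.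
have redb : e < b -> a <= b -> exists a' b',
    [/\ markovz a' b' e, edge_cong e a' b' u u', a' <= e & b' <= e].
  move=> eb ab; have mk' : markovz e a b by do 2 apply: markovz_rot.
  have [_ _ r] := markovz_max mk' (ltW eb) ab (ltac:(lia)).
  have mk2 := markovz_mut mk'; have [_ _ r0 _] := mk2.
  apply: (IH (3 * e * a - b) a); [lia|exact: markovz_swap (markovz_rot mk2)|].
  have D x y : (3 * e * a - b) * x - a * y = (3 * a * x) * e - (b * x + a * y) by ring.
  by apply/andP; rewrite !D; split; rewrite rpredB // dvdz_mull.
have reda : e < a -> b <= a -> exists a' b',
    [/\ markovz a' b' e, edge_cong e a' b' u u', a' <= e & b' <= e].
  move=> ea ba; have mk' : markovz b e a by apply: markovz_rot.
  have [_ _ r] := markovz_max mk' ba (ltW ea) (ltac:(lia)).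
  have mk2 := markovz_mut mk'; have [_ _ r0 _] := mk2.
  apply: (IH b (3 * b * e - a)); [lia|exact: markovz_swap (markovz_rot (markovz_rot mk2))|].
  have D x y : b * x - (3 * b * e - a) * y = (b * x + a * y) - (3 * b * y) * e by ring.
  by apply/andP; rewrite !D; split; rewrite rpredB // dvdz_mull.
have [ae|ea] := leP a e; have [be|eb] := leP b e.
- by exists a, b; split => //; apply/andP.
- by apply: redb => //; lia.
- by apply: reda => //; lia.
- by have [ab|/ltW ba] := leP a b; [apply: redb | apply: reda].
Qed.

(** Induction on the label e.  The triangle beyond the edge u u' has apex
    (b u + a u') / e, and its other two sides have labels a, b < e once e is made
    the largest entry of its triple. *)
Lemma cone_min (A N L m : int) : 0 < m -> forall e a b u u',
  markovz a b e -> vdet u u' = e -> edge_cong e a b u u' ->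
  m <= qform A N L u -> m <= qform A N L u' -> 3 * e * m <= bform A N L u u' ->
  forall v, v != 0 -> 0 <= vdet v u' -> 0 <= vdet u v ->
  m <= qform A N L v /\ (qform A N L v = m -> v = u \/ v = u').
Proof.
move=> m0 e; have [n] := ubnP (absz e); elim: n => // n IH in e *.
move=> lt a b u u' mk ome cg Fu Fu' B v v0 s0 t0.
have [a' [b' [mk' cg' ae be]]] := edge_cong_max mk cg.
move: {mk cg a b} a' b' mk' cg' ae be => a b mk cg ae be.
have [a0 b0 e0 E] := mk.
(* For label 1 the vectors [u], [u'] form a basis, in which [v] has the coordinates [s], [t]. *)
have [e1|e1] := leP e 1.
  have {}e1 : e = 1 by lia.
  set s := vdet v u' in s0 *; set t := vdet u v in t0 *.
  have v1 : v.1 = s * u.1 + t * u'.1.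
    by rewrite -[LHS]mul1r -e1 -ome /s /t /vdet; ring.
  have v2 : v.2 = s * u.2 + t * u'.2.
    by rewrite -[LHS]mul1r -e1 -ome /s /t /vdet; ring.
  have Fv : qform A N L v = s ^+ 2 * qform A N L u + t ^+ 2 * qform A N L u' + s * t * bform A N L u u'.
    by rewrite /qform /bform v1 v2; ring.
  have st : (s, t) != (0, 0).
    apply: contra v0 => /eqP[sE tE]; apply/eqP.
    by apply: vec_eq; rewrite ?v1 ?v2 sE tE !mul0r.
  have hs : s ^+ 2 * m <= s ^+ 2 * qform A N L u by rewrite ler_wpM2l // sqr_ge0.
  have ht : t ^+ 2 * m <= t ^+ 2 * qform A N L u' by rewrite ler_wpM2l // sqr_ge0.
  have hst : s * t * (3 * m) <= s * t * bform A N L u u'.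
    by rewrite ler_wpM2l ?mulr_ge0 //; rewrite e1 in B; lia.
  have key : m * (s ^+ 2 + t ^+ 2 + 3 * (s * t)) <= qform A N L v by rewrite Fv; lia.
  have [sE|sE] := eqVneq s 0.
    have tn : t != 0 by apply: contra st => /eqP ->; rewrite sE.
    split; first by nia.
    move=> Fm; right; have t1 : t = 1 by nia.
    by apply: vec_eq; rewrite ?v1 ?v2 sE t1 !mul0r !mul1r !add0r.
  have [tE|tE] := eqVneq t 0.
    split; first by nia.
    move=> Fm; left; have s1 : s = 1 by nia.
    by apply: vec_eq; rewrite ?v1 ?v2 tE s1 !mul0r !mul1r !addr0.
  (* With s, t >= 1 the bound [key] is at least 5 m, so the value [m] is not attained here. *)
  split; first by nia.
  move=> Fm; nia.
have [ae' be' _] := markovz_max mk ae be e1.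
have /andP[h1 h2] := cg.
have /dvdzP[w1 W1] := markovz_dvdN mk h1; have /dvdzP[w2 W2] := markovz_dvdN mk h2.
pose w := (w1, w2).
have omuw : vdet u w = a.
  apply: (mulIf (lt0r_neq0 e0)).
  by rewrite -[in RHS]ome /vdet /= mulrBl -!mulrA -W1 -W2; ring.
have omwu : vdet w u' = b.
  apply: (mulIf (lt0r_neq0 e0)).
  rewrite -[in RHS]ome /vdet /=.
  have -> : (w1 * u'.2 - w2 * u'.1) * e = (w1 * e) * u'.2 - (w2 * e) * u'.1 by ring.
  by rewrite -W1 -W2; ring.
have Fw : e ^+ 2 * qform A N L w =
    b ^+ 2 * qform A N L u + a ^+ 2 * qform A N L u' + a * b * bform A N L u u'.
  have -> : e ^+ 2 * qform A N L w = qform A N L (w1 * e, w2 * e) by rewrite /qform /=; ring.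
  by rewrite -W1 -W2 /qform /bform /=; ring.
have Buw : e * bform A N L u w = 2 * b * qform A N L u + a * bform A N L u u'.
  have -> : e * bform A N L u w = bform A N L u (w1 * e, w2 * e) by rewrite /bform /=; ring.
  by rewrite -W1 -W2 /qform /bform /=; ring.
have Bwu : e * bform A N L w u' = 2 * a * qform A N L u' + b * bform A N L u u'.
  have -> : e * bform A N L w u' = bform A N L (w1 * e, w2 * e) u' by rewrite /bform /=; ring.
  by rewrite -W1 -W2 /qform /bform /=; ring.
(* By the Markov equation a^2 + b^2 + 3 a b e = e^2 + 2 (a^2 + b^2), so the apex is never
   minimal. *)
have mw : m < qform A N L w.
  have i1 : b ^+ 2 * m <= b ^+ 2 * qform A N L u by rewrite ler_wpM2l // sqr_ge0.
  have i2 : a ^+ 2 * m <= a ^+ 2 * qform A N L u' by rewrite ler_wpM2l // sqr_ge0.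
  have i3 : a * b * (3 * e * m) <= a * b * bform A N L u u' by rewrite ler_wpM2l // ltW // mulr_gt0.
  have i4 : e ^+ 2 * m < e ^+ 2 * qform A N L w.
    rewrite Fw; have : e ^+ 2 * m < m * (a ^+ 2 + b ^+ 2 + 3 * (a * b * e)) by nia.
    by lia.
  by move: i4; rewrite ltr_pM2l // exprn_gt0.
have B1 : 3 * a * m <= bform A N L u w.
  rewrite -(ler_pM2l e0) Buw.
  have i3 : a * (3 * e * m) <= a * bform A N L u u' by rewrite ler_wpM2l // ltW.
  have : 0 <= b * qform A N L u by rewrite mulr_ge0 // ?ltW //; lia.
  lia.
have B2 : 3 * b * m <= bform A N L w u'.
  rewrite -(ler_pM2l e0) Bwu.
  have i3 : b * (3 * e * m) <= b * bform A N L u u' by rewrite ler_wpM2l // ltW.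
  have : 0 <= a * qform A N L u' by rewrite mulr_ge0 // ?ltW //; lia.
  lia.
(* The apex splits the cone into the cones over the two outer sides, whose labels are smaller than
   [e]. *)
have [ge0|lt0] := leP 0 (vdet v w).
  have cg1 : edge_cong a b e u w.
    apply/andP; split.
      have -> : b * u.1 - e * w.1 = (- u'.1) * a by rewrite [e * _]mulrC -W1 /=; ring.
      by rewrite dvdz_mull.
    have -> : b * u.2 - e * w.2 = (- u'.2) * a by rewrite [e * _]mulrC -W2 /=; ring.
    by rewrite dvdz_mull.
  have mk1 : markovz b e a by apply: markovz_rot.
  have lt1 : (absz a < n)%N by lia.
  have [g1 g2] := IH a lt1 b e u w mk1 omuw cg1 Fu (ltW mw) B1 v v0 ge0 t0.
  split=> // Fm; case: (g2 Fm) => vE; first by left.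
  by move: mw; rewrite -vE Fm ltxx.
have cg1 : edge_cong b e a w u'.
  apply/andP; split.
    have -> : e * w.1 - a * u'.1 = u.1 * b by rewrite [e * _]mulrC -W1 /=; ring.
    by rewrite dvdz_mull.
  have -> : e * w.2 - a * u'.2 = u.2 * b by rewrite [e * _]mulrC -W2 /=; ring.
  by rewrite dvdz_mull.
have mk1 : markovz e a b by do 2 apply: markovz_rot.
have lt1 : (absz b < n)%N by lia.
have ge0 : 0 <= vdet w v by move: lt0; rewrite /vdet; lia.
have [g1 g2] := IH b lt1 e a w u' mk1 omwu cg1 (ltW mw) Fu' B2 v v0 s0 ge0.
split=> // Fm; case: (g2 Fm) => vE; last by right.
by move: mw; rewrite -vE Fm ltxx.
Qed.

(** * The minimum of a Markov form *)

Definition chain_next (c : int) (u u' : int * int) : int * int :=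
  (3 * c * u'.1 - u.1, 3 * c * u'.2 - u.2).

(** Consecutive minimal vectors on one side of the strip; the translation along
    the strip is (u, u') |-> (u', 3 c u' - u). *)
Definition minpair A N L a b c u u' :=
  [/\ vdet u u' = c, edge_cong c a b u u', qform A N L u = c, qform A N L u' = c &
      bform A N L u u' = 3 * c * c].

(** The translation preserves the form: Q(3 c u' - u) = 9 c^2 c + c - 3 c (3 c^2) = c. *)
Lemma minpair_fwd A N L a b c u u' : markovz a b c ->
  minpair A N L a b c u u' -> minpair A N L a b c u' (chain_next c u u').
Proof.
move=> mk [o /andP[h1 h2] f f' B]; split=> //.
- by rewrite -[in RHS]o /vdet /=; ring.
- have D x y : a * y - b * (3 * c * y - x) = (b * x + a * y) - (3 * b * y) * c by ring.
  by rewrite /edge_cong /= !D !rpredB ?dvdz_mull // (markovz_dvdN mk).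
- have -> : qform A N L (chain_next c u u') =
     9 * c * c * qform A N L u' + qform A N L u - 3 * c * bform A N L u u'.
    by rewrite /qform /bform /chain_next /=; ring.
  by rewrite f f' B; ring.
- have -> : bform A N L u' (chain_next c u u') = 6 * c * qform A N L u' - bform A N L u u'.
    by rewrite /qform /bform /chain_next /=; ring.
  by rewrite f' B; ring.
Qed.

Lemma minpair_bwd A N L a b c u u' : markovz a b c ->
  minpair A N L a b c u u' -> minpair A N L a b c (chain_next c u' u) u.
Proof.
move=> mk [o /andP[h1 h2] f f' B]; split=> //.
- by rewrite -[in RHS]o /vdet /=; ring.
- have D x y : a * (3 * c * x - y) - b * x = (3 * a * x) * c - (b * x + a * y) by ring.
  by rewrite /edge_cong /= !D !rpredB ?dvdz_mull // (markovz_dvdN mk).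
- have -> : qform A N L (chain_next c u' u) =
     9 * c * c * qform A N L u + qform A N L u' - 3 * c * bform A N L u u'.
    by rewrite /qform /bform /chain_next /=; ring.
  by rewrite f f' B; ring.
- have -> : bform A N L (chain_next c u' u) u = 6 * c * qform A N L u - bform A N L u u'.
    by rewrite /qform /bform /chain_next /=; ring.
  by rewrite f B; ring.
Qed.

Lemma qformN A N L v : qform A N L (- v) = qform A N L v.
Proof. by rewrite /qform /=; ring. Qed.

(** [P] allows further invariants to be carried along the strip. *)
Lemma minpair_min A N L a b c (P : int * int -> int * int -> Prop) :
  markovz a b c ->
  (forall u u', P u u' -> minpair A N L a b c u u') ->
  (forall u u', P u u' -> P u' (chain_next c u u')) ->
  (forall u u', P u u' -> P (chain_next c u' u) u) ->
  forall u u', P u u' -> forall v, 0 < qform A N L v ->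
  c <= qform A N L v /\
  (qform A N L v = c -> exists x x', P x x' /\ (v = x \/ v = - x)).
Proof.
move=> mk Pm Pf Pb u u' Puu' v Fv.
(* Up to the factor [c], the two determinants are the coordinates of [v] in [u], [u']; a suitable
   translation along the strip lowers the sum of their absolute values. *)
have [n] := ubnP (absz (vdet v u') + absz (vdet u v))%N.
elim: n => // n IH in u u' Puu' v Fv *.
have [a0 b0 c0 E] := mk.
have [o cg f f' B] := Pm _ _ Puu'.
have cone w : w != 0 -> 0 <= vdet w u' -> 0 <= vdet u w -> c <= qform A N L w /\
  (qform A N L w = c -> exists x x', P x x' /\ w = x).
  move=> w0 s0 t0.
  have Fu : c <= qform A N L u by rewrite f.
  have Fu' : c <= qform A N L u' by rewrite f'.
  have Bu : 3 * c * c <= bform A N L u u' by rewrite B.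
  have [g1 g2] := cone_min c0 mk o cg Fu Fu' Bu w0 s0 t0.
  split=> // /g2[->|->]; first by exists u, u'.
  by exists u', (chain_next c u u'); split=> //; apply: Pf.
have v0 : v != 0 by apply: contraTneq Fv => ->; rewrite -leNgt (_ : qform A N L 0 = 0) // /qform /=; ring.
move=> lt.
wlog s0 : v v0 Fv lt / 0 <= vdet v u'.
  move=> W; have [s0|s0] := leP 0 (vdet v u'); first exact: W.
  have lt' : (absz (vdet (- v) u') + absz (vdet u (- v)) < n.+1)%N.
    by move: lt; rewrite /vdet /=; lia.
  have s0' : 0 <= vdet (- v) u' by move: s0; rewrite /vdet /=; lia.
  have [||g1 g2] := W (- v) _ _ lt' s0'; rewrite ?qformN ?oppr_eq0 //.
  rewrite qformN in g1 g2; split=> // /g2[x [x' [Px xv]]].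
  exists x, x'; split=> //; case: xv => [<-|/oppr_inj ->]; last by left.
  by right; rewrite opprK.
have [t0|t0] := leP 0 (vdet u v).
  by have [g1 g2] := cone v v0 s0 t0; split=> // /g2[x [x' [Px ->]]]; exists x, x'; split=> //; left.
have [s1|s1] := eqVneq (vdet v u') 0.
  have [|||g1 g2] := cone (- v); first by rewrite oppr_eq0.
  - by move: s1; rewrite /vdet /=; lia.
  - by move: t0; rewrite /vdet /=; lia.
  rewrite qformN in g1 g2; split=> // /g2[x [x' [Px xv]]].
  by exists x, x'; split=> //; right; rewrite -xv opprK.
have {s1}s0 : 0 < vdet v u' by rewrite lt_neqAle eq_sym s1.
move: lt; set s := vdet v u' in s0 *; set t := vdet u v in t0 * => lt.
(* Now s > 0 > t. Positivity of this expression drives a Vieta descent: translation replaces the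
   coordinate of larger absolute value by a smaller one. *)
have key : c * qform A N L v = s ^+ 2 + t ^+ 2 + 3 * c * (s * t).
  apply: (mulfI (lt0r_neq0 c0)).
  have -> : c * (s ^+ 2 + t ^+ 2 + 3 * c * (s * t)) =
     s ^+ 2 * qform A N L u + t ^+ 2 * qform A N L u' + s * t * bform A N L u u'.
    by rewrite f f' B; ring.
  by rewrite -o /s /t /vdet /qform /bform; ring.
have key0 : 0 < s ^+ 2 + t ^+ 2 + 3 * c * (s * t) by rewrite -key mulr_gt0.
have [ts|ts] := ltP (- t) s.
  apply: (IH (chain_next c u' u) u) => //; first exact: Pb.
  have -> : vdet v u = - t by rewrite /t /vdet; ring.
  have -> : vdet (chain_next c u' u) v = s + 3 * c * t by rewrite /t /s /vdet /=; ring.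
  suff : `|s + 3 * c * t| < s by lia.
  have i1 : s * (- (s + 3 * c * t)) < t ^+ 2 by lia.
  have i2 : t * t < s * s by nia.
  have i3 : c * t < 0 by rewrite pmulr_rlt0.
  rewrite ltr_norml; apply/andP; split; last by lia.
  by rewrite -(ltr_pM2l (x := s)); lia.
apply: (IH u' (chain_next c u u')) => //; first exact: Pf.
have -> : vdet u' v = - s by rewrite /s /vdet; ring.
have -> : vdet v (chain_next c u u') = 3 * c * s + t by rewrite /t /s /vdet /=; ring.
suff : `|3 * c * s + t| < - t by lia.
have st : s != - t.
  have i1 : t ^+ 2 <= c * t ^+ 2 by rewrite ler_peMl ?sqr_ge0 //; lia.
  by apply: contraTneq key0 => ->; rewrite -leNgt; lia.
have i1 : (- t) * (3 * c * s + t) < s ^+ 2 by lia.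
have i2 : s * s < t * t by nia.
have i3 : 0 < c * s by rewrite mulr_gt0.
rewrite ltr_norml; apply/andP; split; first by lia.
by rewrite -(ltr_pM2l (x := - t)); lia.
Qed.

(** * The Markov form of a triple and its minimal vectors *)

Section Cohn.
Variables a b c p1 p2 k l : int.
Hypotheses (mk : markovz a b c) (bez : p2 * b - p1 * a = c).
Hypotheses (Hk : a * k = c * p2 + b) (Hl : c * l = k ^+ 2 + 1 - 3 * k * c).

Let N := 3 * c - 2 * k.

(** The counterpart of [Hk] for [b] and [p1]: multiply by [a] and use the Markov equation. *)
Lemma kb_eq : k * b = 3 * b * c - a + c * p1.
Proof.
have [a0 _ _ E] := mk; apply: (mulfI (lt0r_neq0 a0)).
have -> : a * (k * b) = (a * k) * b by ring.
by rewrite Hk; lia.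
Qed.

(** These are consecutive vertices on the side of the strip where the form, of discriminant 9 c^2 -
    4, takes the value [c]. *)
Lemma minpair_bottom : minpair c N l b a c (1, 0) (k, c).
Proof.
have [a0 b0 c0 E] := mk; rewrite /N.
split.
- by rewrite /vdet /=; ring.
- apply/andP; split=> /=; last by rewrite (_ : _ - _ = (- a) * c) ?dvdz_mull //; ring.
  by rewrite Hk (_ : _ - _ = - p2 * c) ?dvdz_mull //; ring.
- by rewrite /qform /=; ring.
- rewrite /qform /=; have -> : l * c ^+ 2 = (c * l) * c by ring.
  by rewrite Hl; ring.
- by rewrite /bform /=; ring.
Qed.

(** On the other side, p2 / a and p1 / b are consecutive vertices: [bez] says that their edge has
    label [c]. The form is -c there, hence the opposite coefficients. *)
Lemma minpair_top : minpair (- c) (- N) (- l) b a c (p2, a) (p1, b).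
Proof.
have [a0 b0 c0 E] := mk; have Hkb := kb_eq; rewrite /N.
have cp2 : c * p2 = a * k - b by rewrite Hk; ring.
have cp1 : c * p1 = k * b + a - 3 * b * c by rewrite Hkb; ring.
split.
- by rewrite /vdet /= -bez; ring.
- apply/andP; split=> /=; last by rewrite [b * a]mulrC subrr dvdz0.
  by rewrite (_ : _ - _ = 1 * c) ?dvdz_mull // -bez; ring.
- apply: (mulfI (lt0r_neq0 c0)); rewrite /qform /=.
  transitivity (- (c * p2) ^+ 2 + (2 * k - 3 * c) * (c * p2) * a - (c * l) * a ^+ 2).
    by ring.
  rewrite cp2 Hl; transitivity (3 * a * b * c - a ^+ 2 - b ^+ 2); first by ring.
  by rewrite -E; ring.
- apply: (mulfI (lt0r_neq0 c0)); rewrite /qform /=.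
  transitivity (- (c * p1) ^+ 2 + (2 * k - 3 * c) * (c * p1) * b - (c * l) * b ^+ 2).
    by ring.
  rewrite cp1 Hl; transitivity (3 * a * b * c - a ^+ 2 - b ^+ 2); first by ring.
  by rewrite -E; ring.
- apply: (mulfI (lt0r_neq0 c0)); rewrite /bform /=.
  transitivity (- 2 * (c * p1) * (c * p2) + (2 * k - 3 * c) * ((c * p2) * b + a * (c * p1))
     - 2 * (c * l) * (a * b)); first by ring.
  rewrite cp1 cp2 Hl; transitivity (3 * c * (3 * a * b * c - a ^+ 2 - b ^+ 2)); first by ring.
  by rewrite -E; ring.
Qed.

Lemma qform_opp v : qform (- c) (- N) (- l) v = - qform c N l v.
Proof. by rewrite /qform; ring. Qed.

(** A rational zero would make the discriminant 9 c^2 - 4 a square, but it lies strictly between (3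
    c - 1)^2 and (3 c)^2. *)
Lemma cohn_neq0 v : v != 0 -> qform c N l v != 0.
Proof.
have [a0 b0 c0 E] := mk => v0; apply/negP => /eqP F0.
have key : (2 * c * v.1 + N * v.2) ^+ 2 = (9 * c ^+ 2 - 4) * v.2 ^+ 2.
  have -> : 9 * c ^+ 2 - 4 = N ^+ 2 - 4 * (c * l) by rewrite Hl /N; ring.
  by apply/eqP; rewrite -subr_eq0 -[X in _ == X](mulr0 (4 * c)) -F0 /qform; apply/eqP; ring.
have q0 : v.2 != 0.
  apply: contra v0 => /eqP q0; move: key; rewrite q0 expr0n !mulr0 addr0 => /eqP.
  rewrite sqrf_eq0 !mulf_eq0 /= => /orP[/eqP|/eqP p0]; first by lia.
  by apply/eqP/vec_eq.
have : (v.2 ^+ 2 %| (2 * c * v.1 + N * v.2) ^+ 2)%Z by rewrite key dvdz_mull.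
rewrite dvdz_pexp2r //= => /dvdzP[z zE].
have zz : z ^+ 2 = 9 * c ^+ 2 - 4.
  by apply: (mulIf (expf_neq0 2 q0)); rewrite -key zE; ring.
have z3 : `|z| < 3 * c by rewrite -(ltr_pXn2r (n := 2)) // ?nnegrE ?real_normK ?num_real; lia.
have z4 : 3 * c - 1 < `|z| by rewrite -(ltr_pXn2r (n := 2)) // ?nnegrE ?real_normK ?num_real; lia.
by lia.
Qed.

(** Positive values are handled from the side of value [c], negative ones from the other side with
    the opposite form. *)
Lemma cohn_min v : v != 0 -> c <= `|qform c N l v|.
Proof.
move=> v0; have := cohn_neq0 v0; case: (ltgtP (qform c N l v) 0) => // Fv _.
  have mk' := markovz_swap mk.
  have Fv' : 0 < qform (- c) (- N) (- l) v by rewrite qform_opp oppr_gt0.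
  have [] := @minpair_min _ _ _ _ _ _ (minpair (- c) (- N) (- l) b a c) mk' (fun _ _ h => h)
     (fun _ _ => minpair_fwd mk') (fun _ _ => minpair_bwd mk') _ _ minpair_top _ Fv'.
  by rewrite qform_opp => h _; rewrite ltr0_norm.
have mk' := markovz_swap mk.
have [h _] := @minpair_min _ _ _ _ _ _ (minpair c N l b a c) mk' (fun _ _ h => h)
     (fun _ _ => minpair_fwd mk') (fun _ _ => minpair_bwd mk') _ _ minpair_bottom _ Fv.
by rewrite gtr0_norm.
Qed.

Let fw (q : int * int) := (q.2, 3 * c * q.2 - q.1).
Let bw (q : int * int) := (3 * c * q.1 - q.2, q.1).
Let fwK : cancel fw bw. Proof. by move=> [x y]; rewrite /fw /bw /=; congr pair; ring. Qed.
Let bwK : cancel bw fw. Proof. by move=> [x y]; rewrite /fw /bw /=; congr pair; ring. Qed.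
(** Pairs of consecutive terms of the two-sided sequence z_{n+1} = 3 c z_n - z_{n-1} through b, a.
    These terms are the determinants of a fixed vertex on one side of the strip with the vertices on
    the other side. *)
Let chain q := exists n, q = iter n fw (b, a) \/ q = iter n bw (b, a).

Let chain_fw q : chain q -> chain (fw q).
Proof.
case=> n [] ->; first by exists n.+1; left.
by case: n => [|n]; [exists 1; left | exists n; right; rewrite /= bwK].
Qed.

Let chain_bw q : chain q -> chain (bw q).
Proof.
case=> n [] ->; last by exists n.+1; right.
by case: n => [|n]; [exists 1; right | exists n; left; rewrite /= fwK].
Qed.

(** The sequence increases in both directions away from its central terms b, a; for a <= b <= c the
    smallest term is [a]. *)
Let chain_ge q : a <= b <= c -> chain q -> a <= q.1.
Proof.
have [a0 b0 c0 E] := mk => /andP[ab bc] [n] [] ->.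
  case: n => [|n] //=.
  have grow z : 0 < z -> 2 * z <= 3 * c * z by move=> z0; rewrite ler_pM2r //; lia.
  suff : a <= (iter n fw (b, a)).2 /\ (iter n fw (b, a)).2 <= 3 * c * (iter n fw (b, a)).2 - (iter n fw (b, a)).1 by case.
  elim: n => [|n].
    have i1 : c * 1 <= c * a by rewrite ler_pM2l //; lia.
    have i2 : 1 * a <= c * a by rewrite ler_pM2r //; lia.
    by split=> //=; lia.
 
  rewrite iterS; case: (iter n fw (b, a)) => x y; rewrite /fw /= => -[h1 h2].
  by split; [lia | have := grow (3 * c * y - x); lia].
have grow z : 0 < z -> 2 * z <= 3 * c * z by move=> z0; rewrite ler_pM2r //; lia.
suff : a <= (iter n bw (b, a)).1 /\ (iter n bw (b, a)).1 <= 3 * c * (iter n bw (b, a)).1 - (iter n bw (b, a)).2 by case.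
elim: n => [|n]; first by split=> //=; have := grow b b0; lia.
rewrite iterS; case: (iter n bw (b, a)) => x y; rewrite /bw /= => -[h1 h2].
by split; [lia | have := grow (3 * c * x - y); lia].
Qed.

(** This recovers the smallest label from the form: up to sign, [u] and [w] lie on opposite sides of
    the strip, so their determinant is a term of the chain. *)
Lemma cohn_sep u w : a <= b <= c -> qform c N l u = c -> qform c N l w = - c ->
  a <= `|vdet u w|.
Proof.
have [a0 b0 c0 E] := mk; have mk' := markovz_swap mk => abc Fu Fw.
(* [J] follows both sides of the strip simultaneously. *)
pose J x x' := minpair c N l b a c x x' /\ exists y y',
  [/\ minpair (- c) (- N) (- l) b a c y' y, vdet x y = b, vdet x y' = a, vdet x' y' = b &
      vdet x' y = 3 * c * b - a].
have Fu' : 0 < qform c N l u by rewrite Fu.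
have [||||_] := @minpair_min _ _ _ _ _ _ J mk' _ _ _ (1, 0) (k, c) _ _ Fu'.
- by move=> ? ? [].
(* The two sides are oriented oppositely: a forward translation on one is a backward one on the
   other. *)
- move=> x x' [m [y [y' [m' h1 h2 h3 h4]]]]; split; first exact: minpair_fwd.
  exists y', (chain_next c y y'); split=> //; first exact: minpair_bwd.
  + have -> : vdet x' (chain_next c y y') = 3 * c * vdet x' y' - vdet x' y by rewrite /vdet /=; ring.
    by rewrite h3 h4; ring.
  + have -> : vdet (chain_next c x x') (chain_next c y y') = 9 * c ^+ 2 * vdet x' y' - 3 * c * vdet x' y - 3 * c * vdet x y' + vdet x y by rewrite /vdet /=; ring.
    by rewrite h1 h2 h3 h4; ring.
  + have -> : vdet (chain_next c x x') y' = 3 * c * vdet x' y' - vdet x y' by rewrite /vdet /=; ring.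
    by rewrite h2 h3; ring.
- move=> x x' [m [y [y' [m' h1 h2 h3 h4]]]]; split; first exact: minpair_bwd.
  exists (chain_next c y' y), y; split=> //; first exact: minpair_fwd.
  + have -> : vdet (chain_next c x' x) (chain_next c y' y) = 9 * c ^+ 2 * vdet x y - 3 * c * vdet x y' - 3 * c * vdet x' y + vdet x' y' by rewrite /vdet /=; ring.
    by rewrite h1 h2 h3 h4; ring.
  + have -> : vdet (chain_next c x' x) y = 3 * c * vdet x y - vdet x' y by rewrite /vdet /=; ring.
    by rewrite h1 h4; ring.
  + have -> : vdet x (chain_next c y' y) = 3 * c * vdet x y - vdet x y' by rewrite /vdet /=; ring.
    by rewrite h1 h2; ring.
- split; first exact: minpair_bottom.
  exists (p1, b), (p2, a); split; first exact: minpair_top.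
  + by rewrite /vdet /=; ring.
  + by rewrite /vdet /=; ring.
  + by rewrite /vdet /=; rewrite mulrC Hk; ring.
  + by rewrite /vdet /= kb_eq; ring.
move=> /(_ Fu) [x [x' [[m [y [y' [m' h1 h2 h3 h4]]]] ux]]].
(* Now the vertex [x] below [u] stays fixed while the opposite side is traversed. *)
pose P z' z := minpair (- c) (- N) (- l) b a c z' z /\ chain (vdet x z, vdet x z').
have Fw' : qform (- c) (- N) (- l) w = c by rewrite qform_opp Fw opprK.
have Fw'' : 0 < qform (- c) (- N) (- l) w by rewrite Fw'.
have [||||_] := @minpair_min _ _ _ _ _ _ P mk' _ _ _ y' y _ _ Fw''.
- by move=> ? ? [].
- move=> z' z [mz /chain_bw]; rewrite /bw /= => ch; split; first exact: minpair_fwd.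
  rewrite (_ : vdet x (chain_next c z' z) = 3 * c * vdet x z - vdet x z') // /vdet /=; ring.
- move=> z' z [mz /chain_fw]; rewrite /fw /= => ch; split; first exact: minpair_bwd.
  rewrite (_ : vdet x (chain_next c z z') = 3 * c * vdet x z' - vdet x z) // /vdet /=; ring.
- by split=> //; exists 0; left; rewrite h1 h2.
move=> /(_ Fw') [z' [z [[mz /chain_fw /(chain_ge abc) /= sep] wz]]].
have -> : `|vdet u w| = `|vdet x z'|; last exact: le_trans (ler_norm _).
have omN s t : vdet (- s) t = - vdet s t by rewrite /vdet /=; ring.
have omNr s t : vdet s (- t) = - vdet s t by rewrite /vdet /=; ring.
by case: ux wz => -> [] ->; rewrite ?omN ?omNr ?opprK ?normrN.
Qed.
End Cohn.

(** * Approximation of the Markov irrationals *)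

(** [k] is b/a modulo [c], a square root of -1. Divisibility by [a] is tested after multiplication
    by [b], divisibility by [c] after multiplication by a^2. *)
Lemma markovz_residue a b c p1 p2 : markovz a b c -> p2 * b - p1 * a = c ->
  exists k l, a * k = c * p2 + b /\ c * l = k ^+ 2 + 1 - 3 * k * c.
Proof.
move=> mk bez; have [a0 b0 c0 E] := mk.
have ab := markovz_coprime mk.
have ca := markovz_coprime (markovz_rot (markovz_rot mk)).
have : (a %| c * p2 + b)%Z.
  rewrite -(Gauss_dvdzr _ ab).
  have -> : b * (c * p2 + b) = (3 * b * c - a + c * p1) * a.
    have -> : (3 * b * c - a + c * p1) * a = 3 * a * b * c - a ^+ 2 + c * (p1 * a) by ring.
    by rewrite -E -{2}bez -bez; ring.
  by rewrite dvdz_mull.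
case/dvdzP=> k kE.
have : (c %| k ^+ 2 + 1)%Z.
  rewrite -(Gauss_dvdzr _ (coprimezXr 2 ca)).
  have -> : a ^+ 2 * (k ^+ 2 + 1) = (c * p2 ^+ 2 + 2 * b * p2 + 3 * a * b - c) * c.
    have -> : a ^+ 2 * (k ^+ 2 + 1) = (k * a) ^+ 2 + a ^+ 2 by ring.
    rewrite -kE; have -> : a ^+ 2 = 3 * a * b * c - b ^+ 2 - c ^+ 2 by rewrite -E; ring.
    by ring.
  by rewrite dvdz_mull.
case/dvdzP=> l lE.
by exists k, (l - 3 * k); split; [rewrite kE mulrC | rewrite lE; ring].
Qed.

Definition int_nat_box (K Q : nat) : seq (int * nat) :=
  [seq (i, j) | i <- [seq Posz i - Posz K | i <- iota 0 (K + K)], j <- iota 0 Q].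

Lemma int_nat_boxP K Q (p : int) (q : nat) : `|p| < Posz K -> (q < Q)%N -> (p, q) \in int_nat_box K Q.
Proof.
move=> pK qQ; apply: (allpairs_f (fun i j => (i, j))); last by rewrite mem_iota.
by apply/mapP; exists (absz (p + Posz K)%R); [rewrite mem_iota; lia | lia].
Qed.

Definition offset (R : realType) (x : R) (v : int * int) : R := v.2%:~R * x - v.1%:~R.

Section MarkovNumber.
Variables (R : realType) (c : int).
Hypothesis c0 : 0 < c.

Definition sqrt_disc : R := Num.sqrt (9 * c%:~R ^+ 2 - 4).

Let cR : (0 : R) < c%:~R. Proof. by rewrite ltr0z. Qed.
Let cR1 : (1 : R) <= c%:~R. Proof. by rewrite ler1z; lia. Qed.

Lemma sqrt_disc_sqr : sqrt_disc ^+ 2 = 9 * c%:~R ^+ 2 - 4.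
Proof. by rewrite sqr_sqrtr //; have := cR1; nra. Qed.

Lemma sqrt_disc_gt0 : 0 < sqrt_disc.
Proof. by rewrite sqrtr_gt0; have := cR1; nra. Qed.

Lemma sqrt_disc_lt : sqrt_disc < 3 * c%:~R.
Proof. by have := sqrt_disc_sqr; have := sqrt_disc_gt0; have := cR1; nra. Qed.

Lemma lagrange_sqrt_disc : Num.sqrt (9 - 4 / c%:~R ^+ 2) = sqrt_disc / c%:~R.
Proof.
have -> : 9 - 4 / c%:~R ^+ 2 = (sqrt_disc / c%:~R) ^+ 2 :> R.
  by rewrite expr_div_n sqrt_disc_sqr; field; exact: lt0r_neq0.
by rewrite sqrtr_sqr ger0_norm // divr_ge0 // ltW // sqrt_disc_gt0.
Qed.

Lemma half_sqrt_disc : Num.sqrt (9 / 4 - 1 / c%:~R ^+ 2) = sqrt_disc / (2 * c%:~R).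
Proof.
have -> : 9 / 4 - 1 / c%:~R ^+ 2 = (sqrt_disc / (2 * c%:~R)) ^+ 2 :> R.
  by rewrite expr_div_n sqrt_disc_sqr; field; exact: lt0r_neq0.
by rewrite sqrtr_sqr ger0_norm // divr_ge0 // ?ltW ?sqrt_disc_gt0 ?mulr_gt0.
Qed.

Variables (k l : int) (x : R).
Hypothesis Hl : c * l = k ^+ 2 + 1 - 3 * k * c.
Hypothesis Hx : 2 * c%:~R * x = 2 * k%:~R - 3 * c%:~R + sqrt_disc.

Let lR : c%:~R * l%:~R = k%:~R ^+ 2 + 1 - 3 * k%:~R * c%:~R :> R.
Proof. by rewrite -intrM Hl !expr2 !(rmorphB, rmorphD, rmorphM). Qed.

(** Factorisation of the form over its roots, [x] and its conjugate x - D / c with D the root of the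
    discriminant. *)
Lemma qform_offset v : (qform c (3 * c - 2 * k) l v)%:~R =
  offset x v * (c%:~R * offset x v - sqrt_disc * v.2%:~R).
Proof.
apply: (mulfI (lt0r_neq0 cR)).
have Dx : sqrt_disc = 2 * c%:~R * x - 2 * k%:~R + 3 * c%:~R by rewrite Hx; ring.
have := sqrt_disc_sqr; rewrite Dx !expr2 => S.
rewrite /qform /offset !expr2 !(rmorphB, rmorphD, rmorphM) /=.
have -> : c%:~R * (c%:~R * (v.1%:~R * v.1%:~R) + (3 * c%:~R - 2 * k%:~R) * v.1%:~R * v.2%:~R + l%:~R * (v.2%:~R * v.2%:~R)) =
 c%:~R * (c%:~R * v.1%:~R ^+ 2 + (3 * c%:~R - 2 * k%:~R) * v.1%:~R * v.2%:~R) + (c%:~R * l%:~R) * v.2%:~R ^+ 2 :> R by ring.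
rewrite lR.
have -> : k%:~R ^+ 2 + 1 - 3 * k%:~R * c%:~R = - c%:~R ^+ 2 * x ^+ 2 - (3 * c%:~R - 2 * k%:~R) * c%:~R * x :> R.
  by lra.
by ring.
Qed.

(** The vertices (1, 0), (k, c), ... of one side of the strip satisfy q |y| = c (1 - r^(2n)) / D,
    strictly below c / D. *)
Lemma good_fractions_infinite : infinite_set (good_fractions x (sqrt_disc / c%:~R)).
Proof.
(* [r] and [rho] are the eigenvalues of the translation along the strip. *)
pose r : R := (3 * c%:~R - sqrt_disc) / 2.
pose rho : R := (3 * c%:~R + sqrt_disc) / 2.
have S := sqrt_disc_sqr; have D0 := sqrt_disc_gt0; have D3 := sqrt_disc_lt.
have r0 : 0 < r by rewrite /r; lra.
have rr : r * rho = 1 by rewrite /r /rho; lra.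
have rs : r + rho = 3 * c%:~R by rewrite /r /rho; lra.
have r1 : r < 1 by rewrite /r /rho in rr *; nra.
pose u n := iter n (fun p => (p.2, chain_next c p.1 p.2)) ((1, 0), (k, c)).
have rec (z : R) : z * (3 * c%:~R) = z * z + 1 -> forall n, z ^+ n.+2 = 3 * c%:~R * z ^+ n.+1 - z ^+ n.
  move=> zE n; rewrite !exprS; have -> : z * (z * z ^+ n) = (z * z) * z ^+ n by ring.
  have -> : z * z = z * (3 * c%:~R) - 1 by rewrite zE; ring.
  by ring.
have inv n : [/\ offset x (u n).1 = - r ^+ n, offset x (u n).2 = - r ^+ n.+1,
    (u n).1.2%:~R * sqrt_disc = c%:~R * (rho ^+ n - r ^+ n) &
    (u n).2.2%:~R * sqrt_disc = c%:~R * (rho ^+ n.+1 - r ^+ n.+1)].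
  elim: n => [|n [h1 h2 h3 h4]].
    rewrite /u /offset /= !expr0 !expr1; split; [by ring| |by ring|by rewrite /rho /r; field].
    by apply: (mulfI (lt0r_neq0 (x := 2 : R) _)) => //; rewrite /r; have := Hx; lra.
  rewrite /u iterS -/(u n) /=; split=> //.
    rewrite (rec r); last by rewrite -rs; lra.
    have -> : offset x (chain_next c (u n).1 (u n).2) = 3 * c%:~R * offset x (u n).2 - offset x (u n).1.
      by rewrite /offset /chain_next /= !rmorphB !rmorphM /=; ring.
    by rewrite h1 h2; ring.
  rewrite (rec r); last by rewrite -rs; lra.
  rewrite (rec rho); last by rewrite -rs; lra.
  rewrite !rmorphB !rmorphM /= mulrBl h3 -mulrA h4; ring.
have rn0 n : 0 < r ^+ n by rewrite exprn_gt0.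
have rrn n : r ^+ n * rho ^+ n = 1 by rewrite -exprMn rr expr1n.
have rn1 n : r ^+ n.+1 < 1 by rewrite exprn_ilt1 // ltW.
have q0 n : (0 < (u n.+1).1.2)%R.
  have [_ _ h3 _] := inv n.+1.
  rewrite -(ltr0z R) -(pmulr_lgt0 _ D0) h3 mulr_gt0 // subr_gt0.
  by have := rrn n.+1; have := rn1 n; have := rn0 n.+1; nra.
(* The index starts at 1 because the first vertex (1, 0) has denominator 0. *)
pose f n : int * nat := ((u n.+1).1.1, absz (u n.+1).1.2).
have fP n : good_fractions x (sqrt_disc / c%:~R) (f n).
  have qE : (absz (u n.+1).1.2)%:R = (u n.+1).1.2%:~R :> R.
    by rewrite -[in RHS](gtz0_abs (q0 n)).
  rewrite /good_fractions /= qE; split; first by rewrite absz_gt0 (lt0r_neq0 (q0 n)).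
  have [h1 _ h3 _] := inv n.+1; have Q := q0 n; rewrite -(ltr0z R) in Q.
  set q : R := _%:~R in h3 Q *.
  have -> : x - (u n.+1).1.1%:~R / q = - r ^+ n.+1 / q.
    by rewrite -h1 /offset -/q; field; exact: lt0r_neq0.
  rewrite mulNr normrN ger0_norm ?divr_ge0 ?ltW //.
  have -> : 1 / (sqrt_disc / c%:~R * q ^+ 2) = c%:~R / (q * sqrt_disc) / q.
    by field; rewrite ?lt0r_neq0.
  rewrite ltr_pM2r ?invr_gt0 // ltr_pdivlMr ?mulr_gt0 // h3 mulrCA.
  rewrite -[ltRHS]mulr1 ltr_pM2l // mulrBr rrn ltrBlDr ltrDl.
  exact: mulr_gt0.
have finj : injective f.
  move=> n n' [] e1 e2.
  have e3 : (u n.+1).1 = (u n'.+1).1.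
    apply: vec_eq; first exact: e1.
    by rewrite -(gtz0_abs (q0 n)) -(gtz0_abs (q0 n')) e2.
  have [h1 _ _ _] := inv n.+1; have [h1' _ _ _] := inv n'.+1.
  have : r ^+ n.+1 = r ^+ n'.+1 by apply: oppr_inj; rewrite -h1 e3 h1'.
  by move/(ieexprIn r0 (negbT (lt_eqF r1))) => [].
move=> /finite_seqP[s sE].
have : (size (map f (iota 0 (size s).+1)) <= size s)%N.
  apply: uniq_leq_size; first by rewrite map_inj_uniq ?iota_uniq.
  by move=> _ /mapP[n _ ->]; have := fP n; rewrite sE.
by rewrite size_map size_iota ltnn.
Qed.

(** Put T = lambda q |y| < 1. The minimum [c] of the form gives (lambda q)^2 <= T lambda lam0 q^2 +
    T^2, so lambda (lambda - lam0) q^2 < 1; this bounds [q], and then [p]. *)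
Lemma good_fractions_finite lambda :
  (forall v, v != 0 -> c <= `|qform c (3 * c - 2 * k) l v|) ->
  sqrt_disc / c%:~R < lambda -> finite_set (good_fractions x lambda).
Proof.
move=> min; set lam0 := sqrt_disc / c%:~R => lt.
have lam00 : 0 < lam0 by rewrite divr_gt0 // sqrt_disc_gt0.
have lam_gt0 : 0 < lambda by exact: lt_trans lt.
pose M := (lambda * (lambda - lam0))^-1.
have M0 : 0 < M by rewrite invr_gt0 mulr_gt0 // subr_gt0.
pose Q := Num.bound M; have QP : M < Q%:R by apply: archi_boundP; exact: ltW.
pose K := Num.bound (Q%:R * `|x| + lambda^-1).
have KP : Q%:R * `|x| + lambda^-1 < K%:R.
  by apply: archi_boundP; rewrite addr_ge0 ?mulr_ge0 // invr_ge0 ltW.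
apply: (@sub_finite_set _ _ [set` int_nat_box K Q]);
  last exact: finite_seq.
move=> [p q] /= [q0 h].
have q0R : 0 < q%:R :> R by rewrite ltr0n.
have q1R : 1 <= q%:R :> R by rewrite ler1n.
pose v := (p, Posz q).
have offsetE : offset x v = q%:R * x - p%:~R by [].
have vE : v.2%:~R = q%:R :> R by [].
have hv : `|offset x v| * q%:R < lambda^-1.
  have -> : `|offset x v| = q%:R * `|x - p%:~R / q%:R|.
    rewrite offsetE.
    rewrite (_ : q%:R * x - p%:~R = q%:R * (x - p%:~R / q%:R)) ?normrM ?(gtr0_norm q0R) //.
    by field; exact: lt0r_neq0.
  rewrite mulrAC -expr2 mulrC -ltr_pdivlMr ?exprn_gt0 //; apply: (lt_le_trans h).
  by rewrite div1r invfM.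
have v0 : v != 0 by apply/eqP => -[_ qE]; rewrite qE in q0.
have cv : 1 <= `|offset x v| * (lam0 * q%:R + `|offset x v|).
  have := min v v0; rewrite -(ler_int R) intr_norm qform_offset normrM => cv.
  rewrite -(ler_pM2l cR) mulr1; apply: (le_trans cv).
  rewrite mulrCA ler_wpM2l //.
  have -> : c%:~R * offset x v - sqrt_disc * v.2%:~R = c%:~R * (offset x v - lam0 * q%:R).
    by rewrite vE /lam0; field; exact: lt0r_neq0.
  rewrite normrM (gtr0_norm cR) ler_pM2l // (le_trans (ler_normB _ _)) //.
  by rewrite addrC lerD2r ger0_norm // mulr_ge0 // ltW.
set Y := `|offset x v| in hv cv.
have Y0 : 0 <= Y by exact: normr_ge0.
have lY : lambda * (Y * q%:R) < 1 by rewrite mulrC -ltr_pdivlMr // div1r.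
have qM : q%:R ^+ 2 < M.
  rewrite /M -[ltRHS]div1r ltr_pdivlMr ?mulr_gt0 ?subr_gt0 //.
  have i1 : (lambda * q%:R) ^+ 2 * 1 <= (lambda * q%:R) ^+ 2 * (Y * (lam0 * q%:R + Y)).
    by rewrite ler_wpM2l // sqr_ge0.
  set T := lambda * (Y * q%:R) in lY.
  have T0 : 0 <= T by rewrite /T !mulr_ge0 // ltW.
  have i2 : (lambda * q%:R) ^+ 2 * (Y * (lam0 * q%:R + Y)) = T * (lambda * lam0 * q%:R ^+ 2) + T ^+ 2.
    by rewrite /T; ring.
  have i3 : T * (lambda * lam0 * q%:R ^+ 2) <= 1 * (lambda * lam0 * q%:R ^+ 2).
    by apply: ler_wpM2r; [exact: mulr_ge0 (mulr_ge0 (ltW lam_gt0) (ltW lam00)) (sqr_ge0 _) | exact: ltW].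
  have i4 : T ^+ 2 < 1 by rewrite expr_lt1 // ltW.
  by lra.
have qQ : (q < Q)%N.
  rewrite -(ltr_nat R); apply: le_lt_trans (lt_trans qM QP).
  by rewrite expr2 ler_peMl // ltW.
have pK : `|p%:~R| < K%:R :> R.
  apply: le_lt_trans KP.
  have -> : p%:~R = q%:R * x - offset x v :> R by rewrite offsetE; ring.
  apply: (le_trans (ler_normB _ _)); apply: lerD.
    by rewrite normrM ger0_norm ?ler0n // ler_wpM2r // ler_nat ltnW.
  by apply: (le_trans _ (ltW hv)); rewrite ler_peMr.
have pK' : `|p| < Posz K by rewrite -(ltr_int R) intr_norm.
exact: (int_nat_boxP pK' qQ).
Qed.
End MarkovNumber.

(** * Equivalent Markov irrationals come from the same triple *)

(** The last equation says that [x] is the larger root of the form with coefficients c, 3 c - 2 k,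
    l. *)
Definition markov_data (R : realType) (a b c p1 p2 k l : int) (x : R) : Prop :=
  [/\ markovz a b c, p2 * b - p1 * a = c, a * k = c * p2 + b,
      c * l = k ^+ 2 + 1 - 3 * k * c &
      2 * c%:~R * x = 2 * k%:~R - 3 * c%:~R + sqrt_disc R c].

(** A relation m x + n = 0 would make (-n, m) a zero of the Markov form. *)
Lemma markov_data_irr (R : realType) a b c p1 p2 k l (x : R) :
  markov_data a b c p1 p2 k l x -> forall m n : int, m%:~R * x + n%:~R = 0 ->
  m = 0 /\ n = 0.
Proof.
case=> mk bez Hk Hl Hx m n mn0; have [a0 b0 c0 E] := mk.
have o0 : offset x (- n, m) = 0 by rewrite /offset /= rmorphN /= opprK.
have [[nE ->]|v0] := eqVneq (- n, m) 0; first by split=> //; lia.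
have := cohn_neq0 mk bez Hk Hl v0.
by rewrite -(intr_eq0 R) (qform_offset c0 Hl Hx) o0 mul0r eqxx.
Qed.

Lemma normz_neq_opp (A c : int) : `|A| = c -> A <> c -> A = - c.
Proof. by lia. Qed.

Lemma disc_eq (c c' : int) : 0 < c -> 0 < c' ->
  c' ^+ 2 * (9 * c ^+ 2 - 4) = c ^+ 2 * (9 * c' ^+ 2 - 4) -> c = c'.
Proof.
move=> c0 c0' e; have : c' ^+ 2 = c ^+ 2 by lia.
by move/eqP; rewrite eqrXn2 ?ltW // => /eqP.
Qed.

(** The form of [x], pulled back by the matrix, has the root [x'] and so is proportional to the form
    of [x']. Comparing minima and discriminants gives c = c' and a factor 1 or -1, and [cohn_sep]
    then bounds [a] by [a']. *)
Lemma markov_data_equiv_le (R : realType) a b c p1 p2 k l (x : R)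
    a' b' c' p1' p2' k' l' (x' : R) (h11 h12 h21 h22 : int) (t : R) :
  markov_data a b c p1 p2 k l x -> markov_data a' b' c' p1' p2' k' l' x' ->
  a <= b <= c ->
  (h11 * h22 - h12 * h21) ^+ 2 = 1 ->
  h11%:~R * x' + h12%:~R = t * x -> h21%:~R * x' + h22%:~R = t ->
  c = c' /\ a <= a'.
Proof.
move=> d d' abc det e1 e2; have irr' := markov_data_irr d'.
have [mk bez Hk Hl Hx] := d; have [mk' bez' Hk' Hl' Hx'] := d'.
have [a0 b0 c0 E] := mk; have [a0' b0' c0' E'] := mk'.
have [N NE] : exists N, N = 3 * c - 2 * k by exists (3 * c - 2 * k).
have [N' NE'] : exists N', N' = 3 * c' - 2 * k' by exists (3 * c' - 2 * k').
pose H (v : int * int) := (h11 * v.1 + h12 * v.2, h21 * v.1 + h22 * v.2).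
(* Coefficients of the pulled-back form. *)
pose A1 := c * h11 ^+ 2 + N * h11 * h21 + l * h21 ^+ 2.
pose N1 := 2 * c * h11 * h12 + N * (h11 * h22 + h12 * h21) + 2 * l * h21 * h22.
pose L1 := c * h12 ^+ 2 + N * h12 * h22 + l * h22 ^+ 2.
have FH v : qform c N l (H v) = qform A1 N1 L1 v.
  by rewrite /qform /H /A1 /N1 /L1 /=; ring.
have disc1 : N1 ^+ 2 - 4 * (A1 * L1) = 9 * c ^+ 2 - 4.
  transitivity ((h11 * h22 - h12 * h21) ^+ 2 * (N ^+ 2 - 4 * (c * l))).
    by rewrite /A1 /N1 /L1; ring.
  by rewrite det Hl NE; ring.
have disc2 : N' ^+ 2 - 4 * (c' * l') = 9 * c' ^+ 2 - 4 by rewrite Hl' NE'; ring.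
have root x0 c1 k1 l1 : 0 < c1 -> c1 * l1 = k1 ^+ 2 + 1 - 3 * k1 * c1 ->
    2 * c1%:~R * x0 = 2 * k1%:~R - 3 * c1%:~R + sqrt_disc R c1 ->
    c1%:~R * x0 ^+ 2 + (3 * c1 - 2 * k1)%:~R * x0 + l1%:~R = 0 :> R.
  move=> c10 Hl1 Hx1; have S := sqrt_disc_sqr R c10.
  apply: (mulfI (_ : 4 * c1%:~R != 0 :> R)).
    by rewrite mulf_neq0 ?intr_eq0 ?lt0r_neq0.
  have lR : c1%:~R * l1%:~R = k1%:~R ^+ 2 + 1 - 3 * k1%:~R * c1%:~R :> R.
    by rewrite -intrM Hl1 !expr2 !(rmorphB, rmorphD, rmorphM).
  have : sqrt_disc R c1 = 2 * c1%:~R * x0 - (2 * k1%:~R - 3 * c1%:~R) by rewrite Hx1; ring.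
  move=> DE; rewrite DE in S.
  have -> : (3 * c1 - 2 * k1)%:~R = 3 * c1%:~R - 2 * k1%:~R :> R.
    by rewrite !(rmorphB, rmorphM).
  transitivity (4 * c1%:~R ^+ 2 * x0 ^+ 2 + 4 * c1%:~R * (3 * c1%:~R - 2 * k1%:~R) * x0 + 4 * (c1%:~R * l1%:~R) : R).
    by ring.
  by rewrite lR; lra.
have r1 := root _ _ _ _ c0 Hl Hx; have r2 := root _ _ _ _ c0' Hl' Hx'.
rewrite -NE in r1; rewrite -NE' in r2.
have r3 : A1%:~R * x' ^+ 2 + N1%:~R * x' + L1%:~R = 0.
  transitivity (c%:~R * (h11%:~R * x' + h12%:~R) ^+ 2
     + N%:~R * (h11%:~R * x' + h12%:~R) * (h21%:~R * x' + h22%:~R)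
     + l%:~R * (h21%:~R * x' + h22%:~R) ^+ 2).
    by rewrite /A1 /N1 /L1 !expr2 !(rmorphD, rmorphM) /=; ring.
  rewrite e1 e2; transitivity (t ^+ 2 * (c%:~R * x ^+ 2 + N%:~R * x + l%:~R)); first by ring.
  by rewrite r1 mulr0.
(* Eliminating x'^2 from the two equations leaves a linear relation for the irrational [x'], whose
   coefficients vanish. *)
have [p1E p2E] : c' * N1 - A1 * N' = 0 /\ c' * L1 - A1 * l' = 0.
  apply: irr'; rewrite !(rmorphB, rmorphM) /=.
  transitivity (c'%:~R * (A1%:~R * x' ^+ 2 + N1%:~R * x' + L1%:~R) -
     A1%:~R * (c'%:~R * x' ^+ 2 + N'%:~R * x' + l'%:~R)); first by ring.
  by rewrite r2 r3 !mulr0 subr0.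
have prop v : c' * qform A1 N1 L1 v = A1 * qform c' N' l' v.
  transitivity (A1 * qform c' N' l' v + (c' * N1 - A1 * N') * v.1 * v.2 + (c' * L1 - A1 * l') * v.2 ^+ 2).
    by rewrite /qform; ring.
  by rewrite p1E p2E; ring.
have discE : c' ^+ 2 * (9 * c ^+ 2 - 4) = A1 ^+ 2 * (9 * c' ^+ 2 - 4).
  rewrite -disc1 -disc2.
  transitivity ((c' * N1) ^+ 2 - 4 * (c' * A1) * (c' * L1)); first by ring.
  rewrite (subr0_eq p1E) (subr0_eq p2E).
  by ring.
have Hinj v : H v = 0 -> v = 0.
  case=> h1 h2; set dt := h11 * h22 - h12 * h21 in det.
  have g1 : dt * v.1 = 0.
    transitivity (h22 * (h11 * v.1 + h12 * v.2) - h12 * (h21 * v.1 + h22 * v.2)).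
      by rewrite /dt; ring.
    by rewrite h1 h2 !mulr0 subr0.
  have g2 : dt * v.2 = 0.
    transitivity (h11 * (h21 * v.1 + h22 * v.2) - h21 * (h11 * v.1 + h12 * v.2)).
      by rewrite /dt; ring.
    by rewrite h1 h2 !mulr0 subr0.
  have dt0 : dt != 0 by apply: contraTneq isT => dt0; move: det; rewrite dt0 expr0n.
  by apply: vec_eq; apply: (mulfI dt0); rewrite mulr0.
have A1E : qform A1 N1 L1 (1, 0) = A1 by rewrite /qform /=; ring.
have ge1 : c <= `|A1|.
  rewrite -A1E -FH NE; apply: cohn_min mk bez Hk Hl _ _.
  by apply/eqP => /Hinj [].
(* The vector [v] is the preimage of (1, 0), so c' c = |A1| |F'(v)| >= |A1| c' for the form F' of
   [x']. *)
have le1 : `|A1| <= c.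
  pose dt := h11 * h22 - h12 * h21; pose v := (dt * h22, - dt * h21).
  have HvE : H v = (1, 0).
    apply: vec_eq; rewrite /H /v /=; last by ring.
    by rewrite -det /dt; ring.
  have v0 : v != 0.
    by apply/eqP => vE; move: HvE; rewrite vE /H /= !mulr0.
  have := prop v; rewrite -FH HvE (_ : qform c N l (1, 0) = c); last by rewrite /qform /=; ring.
  move/(congr1 (fun z : int => `|z|)); rewrite !normrM (gtr0_norm c0) (gtr0_norm c0') => PE.
  have := cohn_min mk' bez' Hk' Hl' v0; rewrite -NE' => m.
  rewrite -(ler_pM2l c0') PE [leLHS]mulrC; exact: ler_wpM2l.
have A1n : `|A1| = c by apply/eqP; rewrite eq_le ge1 le1.
have A1s : A1 ^+ 2 = c ^+ 2 by rewrite -A1n real_normK ?num_real.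
have cc : c = c' by move: discE; rewrite A1s; apply: disc_eq.
split=> //.
have F1 v : qform c N l (H v) = (if A1 == c then 1 else - 1) * qform c' N' l' v.
  apply: (mulfI (lt0r_neq0 c0')); rewrite FH prop -cc.
  case: eqP => [->|A1c]; first by ring.
  rewrite (normz_neq_opp A1n A1c).
  by ring.
have Fu : qform c' N' l' (1, 0) = c by rewrite /qform cc /=; ring.
(* The vectors (1, 0) and (p2', a') have values of opposite sign and determinant a'; their images
   are minimal vectors of the first form. *)
have [_ _ Fw _ _] := minpair_top mk' bez' Hk' Hl'.
rewrite qform_opp -NE' in Fw.
have Fw' : qform c' N' l' (p2', a') = - c by rewrite -[LHS]opprK Fw cc.
have omE : `|vdet (H (1, 0)) (H (p2', a'))| = a'.
  have -> : vdet (H (1, 0)) (H (p2', a')) = (h11 * h22 - h12 * h21) * a' by rewrite /vdet /H /=; ring.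
  rewrite normrM (gtr0_norm a0').
  have -> : `|h11 * h22 - h12 * h21| = 1; last by rewrite mul1r.
  by apply/eqP; rewrite -(eqrXn2 (n := 2)) // real_normK ?num_real // det.
rewrite -omE; have := F1 (1, 0); have := F1 (p2', a'); rewrite Fu Fw'.
case: eqP => _ g1 g2.
  by apply: (cohn_sep mk bez Hk Hl abc); rewrite -NE; [rewrite g2; ring | rewrite g1; ring].
have -> : `|vdet (H (1, 0)) (H (p2', a'))| = `|vdet (H (p2', a')) (H (1, 0))|.
  by rewrite -normrN; congr `|_|; rewrite /vdet; ring.
by apply: (cohn_sep mk bez Hk Hl abc); rewrite -NE; [rewrite g1; ring | rewrite g2; ring].
Qed.

(** * Cutting sequences in Markov triangulations *)

(** The edge v1 v2, of label [lab_c], is crossed on the way to x.  The denominator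
    of v2 is taken negative, so that both offsets are positive and
    lab_c = |q1| y2 + |q2| y1. *)
Record state := State { lab_a : int; lab_b : int; lab_c : int; v1 : int * int; v2 : int * int }.

Definition apex (s : state) : int * int :=
  (((lab_b s * (v1 s).1 - lab_a s * (v2 s).1) %/ lab_c s)%Z,
   ((lab_b s * (v1 s).2 - lab_a s * (v2 s).2) %/ lab_c s)%Z).

(* [stepA] turns around v1 and [stepB] around v2. *)
Definition stepA s := State (lab_b s) (lab_c s) (lab_a s) (v1 s) (- apex s).
Definition stepB s := State (lab_c s) (lab_a s) (lab_b s) (apex s) (v2 s).

(** The divisibilities make the third vertex -(a v1 + b v2) / c of the triangle behind the edge
    integral. *)
Definition wf_state (s : state) : Prop :=
  [/\ markovz (lab_a s) (lab_b s) (lab_c s), vdet (v1 s) (v2 s) = lab_c s,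
      (lab_c s %| lab_a s * (v1 s).1 + lab_b s * (v2 s).1)%Z &
      (lab_c s %| lab_a s * (v1 s).2 + lab_b s * (v2 s).2)%Z].

(** The reflection x -> -x exchanges the two ends of an edge and the two kinds of turns, so
    statements on B-turns follow from those on A-turns. *)
Definition mirv (v : int * int) : int * int := (v.1, - v.2).
Definition mir s := State (lab_b s) (lab_a s) (lab_c s) (mirv (v2 s)) (mirv (v1 s)).

Lemma apexE s : wf_state s ->
  (lab_c s * (apex s).1 = lab_b s * (v1 s).1 - lab_a s * (v2 s).1) /\
  (lab_c s * (apex s).2 = lab_b s * (v1 s).2 - lab_a s * (v2 s).2).
Proof.
case=> mk _ h1 h2; rewrite /apex /= ![lab_c s * _]mulrC.
by rewrite !divzK // (markovz_dvd mk).
Qed.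

Lemma apex_unique s w : wf_state s ->
  lab_c s * w.1 = lab_b s * (v1 s).1 - lab_a s * (v2 s).1 ->
  lab_c s * w.2 = lab_b s * (v1 s).2 - lab_a s * (v2 s).2 -> apex s = w.
Proof.
move=> ws e1 e2; have [f1 f2] := apexE ws; have [[_ _ c0 _] _ _ _] := ws.
by apply: vec_eq; apply: (mulfI (lt0r_neq0 c0)); rewrite ?f1 ?f2.
Qed.

Lemma wf_stepA s : wf_state s -> wf_state (stepA s).
Proof.
move=> ws; have [e1 e2] := apexE ws; have [mk o h1 h2] := ws.
have [a0 b0 c0 _] := mk; split=> /=; first exact: markovz_rot.
- apply: (mulfI (lt0r_neq0 c0)); rewrite /vdet /=.
  transitivity ((v1 s).2 * (lab_c s * (apex s).1) - (v1 s).1 * (lab_c s * (apex s).2)); first by ring.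
  by rewrite e1 e2 -o /vdet; ring.
- by rewrite mulrN e1 opprB addrC subrK dvdz_mulr.
- by rewrite mulrN e2 opprB addrC subrK dvdz_mulr.
Qed.

Lemma wf_stepB s : wf_state s -> wf_state (stepB s).
Proof.
move=> ws; have [e1 e2] := apexE ws; have [mk o h1 h2] := ws.
have [a0 b0 c0 _] := mk; split=> /=; first by do 2 apply: markovz_rot.
- apply: (mulfI (lt0r_neq0 c0)); rewrite /vdet /=.
  transitivity ((lab_c s * (apex s).1) * (v2 s).2 - (lab_c s * (apex s).2) * (v2 s).1); first by ring.
  by rewrite e1 e2 -o /vdet; ring.
- by rewrite e1 subrK dvdz_mulr.
- by rewrite e2 subrK dvdz_mulr.
Qed.

Lemma wf_mir s : wf_state s -> wf_state (mir s).
Proof.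
case=> mk o h1 h2; split=> /=; first exact: markovz_swap.
- by rewrite -[RHS]o /vdet /=; ring.
- by rewrite addrC.
- by rewrite !mulrN -opprD rpredN addrC.
Qed.

Lemma apex_mir s : wf_state s -> apex (mir s) = - mirv (apex s).
Proof.
move=> ws; have [e1 e2] := apexE ws.
apply: apex_unique; first exact: wf_mir.
- by rewrite /= mulrN e1; ring.
- by rewrite /= opprK e2; ring.
Qed.

Lemma mir_stepA s : wf_state s -> mir (stepA s) = stepB (mir s).
Proof. by move=> ws; rewrite /stepB apex_mir. Qed.

Lemma mir_stepB s : wf_state s -> mir (stepB s) = stepA (mir s).
Proof. by move=> ws; rewrite /stepA apex_mir // opprK. Qed.

(** * The path towards x *)

Section Track.
Variables (R : realType).
Implicit Types (x : R) (s : state).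

(** The apex has positive denominator ([apex_gt0]), so a negative offset puts it to the right of
    [x], where it replaces [v2]. *)
Definition turnA x s := offset x (apex s) < 0.
Definition step x s := if turnA x s then stepA s else stepB s.

Definition valid x s : Prop :=
  [/\ wf_state s, 0 < (v1 s).2, (v2 s).2 < 0, 0 < offset x (v1 s) & 0 < offset x (v2 s)].

Definition irrat x := forall m n : int, m%:~R * x + n%:~R = 0 -> m = 0.

Lemma irratN x : irrat x -> irrat (- x).
Proof.
move=> irr m n h; apply: (irr m (- n)).
by rewrite rmorphN /= -[RHS]oppr0 -h; ring.
Qed.

Lemma offset_mirv x v : offset (- x) (mirv v) = offset x v.
Proof. by rewrite /offset /= rmorphN /=; ring. Qed.

Lemma offsetN x v : offset x (- v) = - offset x v.
Proof. by rewrite /offset /= !rmorphN /=; ring. Qed.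

Lemma offset_neq0 x v : irrat x -> v.2 != 0 -> offset x v != 0.
Proof.
move=> irr; apply: contra_neq => h; apply: (irr _ (- v.1)).
by rewrite -h /offset rmorphN.
Qed.

Lemma apexR x s : wf_state s ->
  ((lab_c s)%:~R * (apex s).2%:~R = (lab_b s)%:~R * (v1 s).2%:~R - (lab_a s)%:~R * (v2 s).2%:~R :> R) /\
  (lab_c s)%:~R * offset x (apex s) = (lab_b s)%:~R * offset x (v1 s) - (lab_a s)%:~R * offset x (v2 s).
Proof.
move=> ws; have [e1 e2] := apexE ws.
have f1 : (lab_c s)%:~R * (apex s).1%:~R = (lab_b s)%:~R * (v1 s).1%:~R - (lab_a s)%:~R * (v2 s).1%:~R :> R.
  by rewrite -!intrM -intrB e1.
have f2 : (lab_c s)%:~R * (apex s).2%:~R = (lab_b s)%:~R * (v1 s).2%:~R - (lab_a s)%:~R * (v2 s).2%:~R :> R.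
  by rewrite -!intrM -intrB e2.
split=> //; rewrite /offset mulrBr f1 mulrA f2; ring.
Qed.

Lemma vdetR x u v : (vdet u v)%:~R = u.2%:~R * offset x v - v.2%:~R * offset x u :> R.
Proof. by rewrite /vdet /offset rmorphB !rmorphM /=; ring. Qed.

Lemma markovzR a b c : markovz a b c ->
  [/\ (0 : R) < a%:~R, (0 : R) < b%:~R, (0 : R) < c%:~R &
   a%:~R ^+ 2 + b%:~R ^+ 2 + c%:~R ^+ 2 = 3 * a%:~R * b%:~R * c%:~R :> R].
Proof.
case=> a0 b0 c0 E; split; rewrite ?ltr0z //.
transitivity ((a ^+ 2 + b ^+ 2 + c ^+ 2)%:~R : R).
  by rewrite !expr2 !(rmorphD, rmorphM).
by rewrite E !rmorphM.
Qed.

Lemma apex_gt0 x s : valid x s -> 0 < (apex s).2.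
Proof.
case=> ws q1 q2 _ _; have [_ e2] := apexE ws; have [[a0 b0 c0 _] _ _ _] := ws.
rewrite -(pmulr_rgt0 _ c0) e2 -mulrN addr_gt0 // ?mulr_gt0 //; lia.
Qed.

Lemma valid_mir x s : valid x s -> valid (- x) (mir s).
Proof.
case=> ws q1 q2 y1 y2; split; rewrite ?offset_mirv //=; first exact: wf_mir.
  by rewrite oppr_gt0.
by rewrite oppr_lt0.
Qed.

Lemma turnA_mir x s : irrat x -> valid x s -> turnA (- x) (mir s) = ~~ turnA x s.
Proof.
move=> irr vs; have [ws _ _ _ _] := vs.
rewrite /turnA apex_mir // offsetN offset_mirv oppr_lt0 -leNgt le_eqVlt eq_sym.
by rewrite (negbTE (offset_neq0 irr _)) // lt0r_neq0 // (apex_gt0 vs).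
Qed.

Lemma step_mir x s : irrat x -> valid x s -> step (- x) (mir s) = mir (step x s).
Proof.
move=> irr vs; have [ws _ _ _ _] := vs.
rewrite /step turnA_mir //; case: ifP => /=; case: ifP => //= _ _.
- by rewrite mir_stepB.
- by rewrite mir_stepA.
Qed.

Lemma valid_step x s : irrat x -> valid x s -> valid x (step x s).
Proof.
move=> irr vs; have q4 := apex_gt0 vs; have [ws q1 q2 y1 y2] := vs.
rewrite /step; case: ifP => t; split=> //=.
- exact: wf_stepA.
- by rewrite oppr_lt0.
- by rewrite offsetN oppr_gt0.
- exact: wf_stepB.
- by move/negbT: t; rewrite -leNgt le_eqVlt eq_sym (negbTE (offset_neq0 irr _)) // lt0r_neq0.
Qed.

Definition track x s n := iter n (step x) s.

Lemma trackS x s n : track x s n.+1 = step x (track x s n).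
Proof. by []. Qed.

Lemma trackD x s m n : track x s (m + n) = track x (track x s n) m.
Proof. exact: iterD. Qed.

Lemma valid_track x s n : irrat x -> valid x s -> valid x (track x s n).
Proof. by move=> irr vs; elim: n => //= n; apply: valid_step. Qed.

Lemma track_mir x s n : irrat x -> valid x s ->
  track (- x) (mir s) n = mir (track x s n).
Proof.
by move=> irr vs; elim: n => //= n ->; apply: step_mir => //; apply: valid_track.
Qed.

(** During A-turns y1 is constant, while y2 / c drops each time by b y1 / (a c) >= y1 / (a b c); so
    y2 could not stay positive. *)
Lemma exists_turnB x s : irrat x -> valid x s -> exists n, ~~ turnA x (track x s n).
Proof.
move=> irr vs; apply: contrapT => no.
have allA n : turnA x (track x s n) by apply: contrapT => h; apply: no; exists n; apply/negP.
pose P : R := (lab_a s)%:~R * (lab_b s)%:~R * (lab_c s)%:~R.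
have [ws _ _ y1 y2] := vs; have [mk _ _ _] := ws; have [a0 b0 c0 _] := markovzR mk.
have P0 : 0 < P by rewrite !mulr_gt0.
have inv n : let t := track x s n in [/\ v1 t = v1 s,
   (lab_a t)%:~R * (lab_b t)%:~R * (lab_c t)%:~R = P &
   offset x (v2 t) * P <= (lab_c t)%:~R * (offset x (v2 s) / (lab_c s)%:~R * P - n%:R * offset x (v1 s))].
  elim: n => [|n].
    split=> //=; rewrite mul0r subr0.
    rewrite (_ : _ * (_ / _ * P) = offset x (v2 s) * P) //.
    by field; exact: lt0r_neq0.
  have vt := valid_track n irr vs; have At := allA n.
  rewrite trackS /step At; set t := track x s n in vt At * => -[e1 e2 e3].
  have [wt _ _ _ z2] := vt; have [mk' _ _ _] := wt; have [a0' b0' c0' _] := markovzR mk'.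
  have [_ f2] := apexR x wt.
  split=> //=; first by rewrite -e2; ring.
  rewrite offsetN -(ler_pM2l c0') mulrA mulrN f2 e1 opprB.
  have b1 : 1 <= (lab_b t)%:~R :> R by rewrite ler1z -gtz0_ge1; case: mk'.
  have i1 : (lab_a t)%:~R * (offset x (v2 t) * P) <= (lab_a t)%:~R * ((lab_c t)%:~R * (offset x (v2 s) / (lab_c s)%:~R * P - n%:R * offset x (v1 s))).
    by rewrite ler_pM2l.
  have i2 : (lab_a t)%:~R * (lab_c t)%:~R * offset x (v1 s) <= (lab_b t)%:~R * offset x (v1 s) * P.
    rewrite -e2.
    have -> : (lab_b t)%:~R * offset x (v1 s) * ((lab_a t)%:~R * (lab_b t)%:~R * (lab_c t)%:~R) = ((lab_a t)%:~R * (lab_c t)%:~R * offset x (v1 s)) * ((lab_b t)%:~R * (lab_b t)%:~R) by ring.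
    by rewrite ler_peMr ?mulr_ege1 // !mulr_ge0 // ltW.
  rewrite -[n.+1]addn1 natrD; lra.
pose C := offset x (v2 s) / (lab_c s)%:~R * P / offset x (v1 s).
have C0 : 0 <= C by rewrite !mulr_ge0 ?invr_ge0 ?ltW.
have [n hn] : exists n : nat, C < n%:R by exists (Num.bound C); apply: archi_boundP.
have vt := valid_track n irr vs.
have [_ _ i] := inv n; have [wt _ _ _ z2] := vt.
have [mk' _ _ _] := wt; have [a0' b0' c0' _] := markovzR mk'.
have : 0 < offset x (v2 (track x s n)) * P by rewrite mulr_gt0.
move/lt_le_trans => /(_ _ i); rewrite pmulr_rgt0 // subr_gt0 => lt.
by move: hn; rewrite /C ltr_pdivrMr // ltNge (ltW lt).
Qed.

(** The distance x - p/q of [v1] never increases and strictly drops at every B-turn, so a vertex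
    once left does not return. *)
Lemma avoid_v1 x s v : irrat x -> valid x s ->
  exists N, forall n, (N <= n)%N -> v1 (track x s n) <> v.
Proof.
move=> irr vs.
pose d n := offset x (v1 (track x s n)) / (v1 (track x s n)).2%:~R.
have dS n : d n.+1 <= d n /\ (~~ turnA x (track x s n) -> d n.+1 < d n).
  rewrite /d trackS /step; have vt := valid_track n irr vs.
  set t := track x s n in vt *; case: ifP => // /negbT _.
  have [wt q1 q2 z1 z2] := vt; have q4 := apex_gt0 vt.
  have [mk' _ _ _] := wt; have [a0' b0' c0' _] := markovzR mk'.
  have [f1 f2] := apexR x wt.
  suff lt : offset x (apex t) / (apex t).2%:~R < offset x (v1 t) / (v1 t).2%:~R.
    by split=> // ; apply: ltW.
  rewrite ltr_pdivrMr ?ltr0z // mulrAC ltr_pdivlMr ?ltr0z // -(ltr_pM2l c0').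
  rewrite mulrA f2 [ltRHS]mulrCA f1.
  have q1R : 0 < (v1 t).2%:~R :> R by rewrite ltr0z.
  have q2R : (v2 t).2%:~R < 0 :> R by rewrite ltrz0.
  have j1 : 0 < (lab_a t)%:~R * (offset x (v2 t) * (v1 t).2%:~R) by rewrite !mulr_gt0.
  have j2 : 0 < (lab_a t)%:~R * (offset x (v1 t) * - (v2 t).2%:~R) by rewrite !mulr_gt0 // oppr_gt0.
  lra.
have dle m n : (m <= n)%N -> d n <= d m.
  move/subnK <-; elim: (n - m)%N => // k IH.
  by rewrite addSn; apply: le_trans IH; case: (dS (k + m)%N).
have [[m mE]|no] := pselect (exists m, v1 (track x s m) = v); last first.
  by exists 0%N => n _ e; apply: no; exists n.
have [k kB] := exists_turnB irr (valid_track m irr vs); rewrite -trackD in kB.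
exists (k + m).+1 => n ln e.
have : d n < d m.
  apply: le_lt_trans (dle _ _ ln) _.
  apply: lt_le_trans (dle m (k + m)%N (leq_addl _ _)).
  by have [_ h] := dS (k + m)%N; apply: h.
by rewrite /d mE e ltxx.
Qed.

Definition good (mu : R) x s :=
  mu <= (v1 s).2%:~R * offset x (v1 s) /\ mu <= - (v2 s).2%:~R * offset x (v2 s).

Lemma avoid_v1_seq x s (E : seq (int * int)) : irrat x -> valid x s ->
  exists N, forall n, (N <= n)%N -> v1 (track x s n) \notin E.
Proof.
move=> irr vs; elim: E => [|e E [N IH]]; first by exists 0%N.
have [M h] := avoid_v1 e irr vs; exists (maxn M N) => n; rewrite geq_max => /andP[n1 n2].
by rewrite inE negb_or IH // andbT; apply/eqP/h.
Qed.

(** The finitely many good fractions are eventually left behind, on the left as [v1] and on the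
    right as [v1] of the mirror image. *)
Lemma good_eventually x lambda s : irrat x -> 0 < lambda ->
  finite_set (good_fractions x lambda) -> valid x s ->
  exists N, forall n, (N <= n)%N -> good lambda^-1 x (track x s n).
Proof.
move=> irr lam0 /finite_seqP[E EE] vs.
have key v : 0 < v.2 -> v \notin [seq (e.1, Posz e.2) | e <- E] ->
    lambda^-1 <= v.2%:~R * `|offset x v|.
  move=> q0 /negP nE; rewrite leNgt; apply/negP => lt; apply: nE.
  have qR : 0 < v.2%:~R :> R by rewrite ltr0z.
  have qE : (absz v.2)%:R = v.2%:~R :> R by rewrite -[in RHS](gtz0_abs q0).
  have : good_fractions x lambda (v.1, absz v.2).
    split=> /=; first by rewrite absz_gt0 lt0r_neq0.
    rewrite qE (_ : x - _ = offset x v / v.2%:~R); last by rewrite /offset; field; exact: lt0r_neq0.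
    rewrite normrM normfV (gtr0_norm qR) ltr_pdivrMr //.
    rewrite (_ : 1 / _ * _ = lambda^-1 / v.2%:~R); last by field; rewrite ?lt0r_neq0.
    by rewrite ltr_pdivlMr // mulrC.
  rewrite EE /= => vE; apply/mapP; exists (v.1, absz v.2) => //=.
  by rewrite gtz0_abs // -surjective_pairing.
set E' := [seq _ | e <- E] in key.
have [N1 h1] := avoid_v1_seq E' irr vs.
have [N2 h2] := avoid_v1_seq [seq mirv e | e <- [seq - e | e <- E']] (irratN irr) (valid_mir vs).
exists (maxn N1 N2) => n; rewrite geq_max => /andP[n1 n2].
have [wt q1 q2 y1 y2] := valid_track n irr vs; split.
  by have := key _ q1 (h1 n n1); rewrite ger0_norm // ltW.
have := h2 n n2; rewrite track_mir //= => nE.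
have := key (- v2 (track x s n)); rewrite offsetN normrN (gtr0_norm y2) /= rmorphN; apply.
  by rewrite oppr_gt0.
apply: contra nE => /(map_f (fun e => - e)) /(map_f mirv); rewrite opprK.
by [].
Qed.
End Track.

(** * Invariants along a strip and the bound at a corner *)

Section Fan.
Variables (R : realType).
Implicit Types (x mu : R) (s : state).

(** Multiply c = q1 y2 - q2 y1 by 3 y1 y2 and bound both products q y from below by [mu] > 1/3. *)
Lemma good_edge mu x s : 1 < 3 * mu -> valid x s -> good mu x s ->
  offset x (v1 s) ^+ 2 + offset x (v2 s) ^+ 2 < 3 * (lab_c s)%:~R * offset x (v1 s) * offset x (v2 s).
Proof.
move=> mu3 [[_ o _ _] q1 q2 y1 y2] [g1 g2].
have := congr1 (fun z : int => z%:~R : R) o; rewrite (vdetR x) => <-.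
move: (offset x (v1 s)) (offset x (v2 s)) ((v1 s).2%:~R : R) ((v2 s).2%:~R : R) y1 y2 g1 g2.
move=> y z q r y0 z0 g1 g2.
have i1 : z ^+ 2 * mu <= z ^+ 2 * (q * y) by rewrite ler_wpM2l // sqr_ge0.
have i2 : y ^+ 2 * mu <= y ^+ 2 * (- r * z) by rewrite ler_wpM2l // sqr_ge0.
have i3 : (y ^+ 2 + z ^+ 2) * 1 < (y ^+ 2 + z ^+ 2) * (3 * mu).
  by rewrite ltr_pM2l // addr_gt0 // exprn_gt0.
lra.
Qed.

Lemma good_mir mu x s : good mu x s -> good mu (- x) (mir s).
Proof. by case=> g1 g2; split; rewrite offset_mirv //= rmorphN ?opprK. Qed.

(** With u0, u1 = v1, u2 the consecutive vertices on the side of the strip bounded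
    by edges of label [lab_b], this is the offset of u2 = 3 lab_b u1 - u0. *)
Definition fan x s : R :=
  ((3 * (lab_b s)%:~R * (lab_c s)%:~R - (lab_a s)%:~R) * offset x (v1 s) - (lab_b s)%:~R * offset x (v2 s)) / (lab_c s)%:~R.

(** The edge inequality for u1, u2; it is symmetric and invariant under (u1, u2) -> (u2, 3 b u2 -
    u1). *)
Definition invA x s :=
  offset x (v1 s) ^+ 2 + fan x s ^+ 2 < 3 * (lab_b s)%:~R * offset x (v1 s) * fan x s.

Lemma fan_stepA x s : wf_state s -> fan x (stepA s) = 3 * (lab_c s)%:~R * offset x (v1 s) - offset x (v2 s).
Proof.
move=> ws; have [_ f2] := apexR x ws; have [mk _ _ _] := ws.
have [a0 b0 c0 E] := markovzR R mk.
rewrite /fan /= offsetN; apply: (mulfI (lt0r_neq0 a0)).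
rewrite mulrCA mulfV ?mulr1 ?lt0r_neq0 // mulrN opprK f2.
ring.
Qed.

Lemma invA_fresh mu x s : 1 < 3 * mu -> valid x s -> good mu x s ->
  turnA x s -> invA x (step x s).
Proof.
move=> mu3 vs gs tA; have := good_edge mu3 vs gs; have [ws _ _ _ _] := vs.
rewrite /step tA /invA fan_stepA //=.
move: (offset x (v1 s)) (offset x (v2 s)) ((lab_c s)%:~R : R) => y z c h.
lra.
Qed.

Lemma invA_fan_gt0 x s : valid x s -> invA x s -> 0 < fan x s.
Proof.
move=> [[mk _ _ _] _ _ y1 _]; have [a0 b0 c0 _] := markovzR R mk.
rewrite /invA => h; rewrite ltNge; apply/negP => f0.
have : 3 * (lab_b s)%:~R * offset x (v1 s) * fan x s <= 0.
  by rewrite mulr_ge0_le0 // !mulr_ge0 // ltW.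
by rewrite leNgt (lt_trans _ h) // ltr_wpDr ?sqr_ge0 // exprn_gt0.
Qed.

(** After an A-turn the next apex is u2; under [invA] its offset is positive, which excludes a
    second A-turn. *)
Lemma offset_apex_stepA x s : wf_state s -> offset x (apex (stepA s)) = fan x s.
Proof.
move=> ws; have [_ f2] := apexR x ws; have [_ f2'] := apexR x (wf_stepA ws).
have [mk _ _ _] := ws; have [a0 b0 c0 E] := markovzR R mk.
rewrite /= offsetN in f2'.
apply: (mulfI (lt0r_neq0 a0)); rewrite f2' /fan; apply: (mulfI (lt0r_neq0 c0)).
transitivity ((lab_c s)%:~R ^+ 2 * offset x (v1 s) + (lab_b s)%:~R * ((lab_c s)%:~R * offset x (apex s))).
  by ring.
rewrite f2; transitivity ((lab_a s)%:~R * ((3 * (lab_b s)%:~R * (lab_c s)%:~R - (lab_a s)%:~R) * offset x (v1 s)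
    - (lab_b s)%:~R * offset x (v2 s))); last by field; exact: lt0r_neq0.
have -> : (lab_c s)%:~R ^+ 2 = 3 * (lab_a s)%:~R * (lab_b s)%:~R * (lab_c s)%:~R - (lab_a s)%:~R ^+ 2 - (lab_b s)%:~R ^+ 2 :> R.
  by rewrite -E; ring.
ring.
Qed.

Lemma invA_noAA x s : valid x s -> invA x s -> turnA x s -> turnA x (step x s) = false.
Proof.
move=> vs ia tA; have [ws _ _ _ _] := vs.
rewrite {1}/turnA /step tA offset_apex_stepA //; apply/negbTE; rewrite -leNgt ltW //.
exact: invA_fan_gt0.
Qed.

Lemma invA_block x s : valid x s -> invA x s -> turnA x s ->
  invA x (step x (step x s)).
Proof.
move=> vs ia tA; have [ws _ _ _ _] := vs.
have nB := invA_noAA vs ia tA.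
have -> : step x (step x s) = stepB (stepA s) by rewrite {1}/step nB /step tA.
have [_ f2] := apexR x (wf_stepA ws).
rewrite /= offsetN in f2.
have [mk _ _ _] := ws; have [a0 b0 c0 E] := markovzR R mk.
have y5 := offset_apex_stepA x ws.
have fE : fan x (stepB (stepA s)) = 3 * (lab_b s)%:~R * fan x s - offset x (v1 s).
  rewrite -y5 {1}/fan /= offsetN; apply: (mulfI (lt0r_neq0 c0)).
  rewrite mulrCA mulfV ?mulr1 ?lt0r_neq0 //.
  transitivity (3 * (lab_b s)%:~R * (lab_c s)%:~R * offset x (apex (stepA s))
     - (lab_a s)%:~R * offset x (apex (stepA s)) + (lab_b s)%:~R * offset x (apex s)); first by ring.
  by rewrite f2; ring.
rewrite /invA fE /= y5; move: ia; rewrite /invA.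
move: (fan x s) (offset x (v1 s)) ((lab_b s)%:~R : R) => f y b h; lra.
Qed.

Definition invB x s := invA (- x) (mir s).

Section Blocks.
Variables (mu x : R).
Hypotheses (mu3 : 1 < 3 * mu) (irr : irrat x).

Lemma invB_fresh s : valid x s -> good mu x s -> ~~ turnA x s -> invB x (step x s).
Proof.
move=> vs gs tB; rewrite /invB -step_mir //; apply: (invA_fresh mu3) => //.
- exact: valid_mir.
- exact: good_mir.
- by rewrite turnA_mir.
Qed.

(** The first turn of a block is followed by the opposite one. One invariant is transported along
    the strip, the other is created anew by the second turn. *)
Lemma block_step s : valid x s -> good mu x s -> good mu x (step x s) ->
  invA x s -> invB x s -> [/\ turnA x (step x s) = ~~ turnA x s,
    invA x (step x (step x s)) & invB x (step x (step x s))].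
Proof.
move=> vs g1 g2 ia ib; have vs1 := valid_step irr vs.
have vm := valid_mir vs; have irrm := irratN irr.
have [tA|tB] := boolP (turnA x s).
  have n := invA_noAA vs ia tA; split; rewrite ?n //; first exact: invA_block.
  by apply: invB_fresh => //; rewrite n.
have tm : turnA (- x) (mir s) by rewrite turnA_mir.
have := invA_noAA vm ib tm; rewrite step_mir // turnA_mir // => /negbFE n.
split; rewrite ?n //; first exact: (invA_fresh mu3).
by have := invA_block vm ib tm; rewrite !step_mir.
Qed.

Lemma blocks s : valid x s -> (forall n, good mu x (track x s n)) -> invA x s -> invB x s ->
  forall j, [/\ turnA x (track x s (j.*2).+1) = ~~ turnA x (track x s j.*2),
    invA x (track x s j.*2) & invB x (track x s j.*2)].
Proof.
move=> vs gs ia ib; elim=> [|j [h1 h2 h3]].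
  by have [] := block_step vs (gs 0%N) (gs 1%N) ia ib.
have v j' := valid_track j' irr vs.
have [_ h4 h5] := block_step (v j.*2) (gs _) (gs (j.*2).+1) h2 h3.
have [h6 _ _] := block_step (v (j.+1).*2) (gs _) (gs (j.+1.*2).+1) h4 h5.
by split.
Qed.

End Blocks.

(* The label of the edge opposite to the corner that the path cuts off. *)
Definition third x s := if turnA x s then lab_b s else lab_a s.

Lemma third_mir x s : irrat x -> valid x s -> third (- x) (mir s) = third x s.
Proof. by move=> irr vs; rewrite /third turnA_mir //; case: turnA. Qed.

(** The values m1, m2, m4 of q |y| at the corner's three vertices satisfy a quadratic identity with
    right-hand side (a b c)^2; replacing them by their lower bound [mu] gives the claim. *)
Lemma corner_bound_A mu x s : 0 < mu -> valid x s -> good mu x s -> good mu x (step x s) ->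
  turnA x s -> lab_a s <= lab_b s -> lab_c s <= lab_b s ->
  mu ^+ 2 * (9 * (lab_b s)%:~R ^+ 2 - 4) <= (lab_b s)%:~R ^+ 2.
Proof.
move=> mu0 [ws q1 q2 y1 y2] [g1 g2]; rewrite /step => + tA; rewrite tA => -[_ /=].
have [f1 f2] := apexR x ws; have [mk o _ _] := ws; have [a0 b0 c0 E] := markovzR R mk.
rewrite offsetN rmorphN /= opprK -(ler_int R (lab_a s)) -(ler_int R (lab_c s)).
have := congr1 (fun z : int => z%:~R : R) o; rewrite (vdetR x) => {}o.
move: (offset x (v1 s)) (offset x (v2 s)) ((v1 s).2%:~R : R) ((v2 s).2%:~R : R) (offset x (apex s)) ((apex s).2%:~R : R) y1 y2 g1 g2 f1 f2 o.
move: ((lab_a s)%:~R : R) ((lab_b s)%:~R : R) ((lab_c s)%:~R : R) a0 b0 c0 E.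
move=> a b c a0 b0 c0 E y z q r y4 q4 y0 z0 g1 g2 f1 f2 o g4 ab cb.
pose m1 := q * y; pose m2 := - r * z; pose m4 := - (q4 * y4).
(* Obtained by eliminating the apex through [f1], [f2] and squaring c = q1 y2 - q2 y1. *)
have key : (a ^+ 2 * m2 - c ^+ 2 * m4) ^+ 2 + (b ^+ 2 * m1) ^+ 2
    + 2 * (b ^+ 2 * m1) * (a ^+ 2 * m2 + c ^+ 2 * m4) = (a * b * c) ^+ 2.
  have -> : c ^+ 2 * m4 = - (c * q4) * (c * y4) by rewrite /m4; ring.
  by rewrite f1 f2 /m1 /m2 -[in RHS]o; ring.
have A1 : a ^+ 2 * mu <= a ^+ 2 * m2 by rewrite ler_wpM2l ?sqr_ge0.
have B1 : b ^+ 2 * mu <= b ^+ 2 * m1 by rewrite ler_wpM2l ?sqr_ge0.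
have C1 : c ^+ 2 * mu <= c ^+ 2 * m4 by rewrite ler_wpM2l ?sqr_ge0 // /m4 -mulrN.
move: key A1 B1 C1; move: (a ^+ 2 * m2) (b ^+ 2 * m1) (c ^+ 2 * m4) => A B C key A1 B1 C1.
pose sA := A - a ^+ 2 * mu; pose sB := B - b ^+ 2 * mu; pose sC := C - c ^+ 2 * mu.
have sA0 : 0 <= sA by rewrite subr_ge0.
have sB0 : 0 <= sB by rewrite subr_ge0.
have sC0 : 0 <= sC by rewrite subr_ge0.
have ab2 : a ^+ 2 <= b ^+ 2 by rewrite lerXn2r // ?nnegrE ltW.
have cb2 : c ^+ 2 <= b ^+ 2 by rewrite lerXn2r // ?nnegrE ltW.
(* As [b] is the largest label, the left-hand side grows in each of A, B, C above the bounds. The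
   polynomial multiplying mu^2 is (a^2 + b^2 + c^2)^2 - 4 a^2 c^2. *)
have low : mu ^+ 2 * ((a ^+ 2 - c ^+ 2) ^+ 2 + b ^+ 2 ^+ 2 + 2 * b ^+ 2 * (a ^+ 2 + c ^+ 2)) <= (a * b * c) ^+ 2.
  rewrite -key -subr_ge0.
  have -> : A = sA + a ^+ 2 * mu by rewrite /sA; ring.
  have -> : B = sB + b ^+ 2 * mu by rewrite /sB; ring.
  have -> : C = sC + c ^+ 2 * mu by rewrite /sC; ring.
  have t1 : 0 <= mu * (sA * (b ^+ 2 - c ^+ 2 + a ^+ 2)).
    by apply: mulr_ge0 (ltW mu0) (mulr_ge0 sA0 (addr_ge0 _ (sqr_ge0 _))); rewrite subr_ge0.
  have t2 : 0 <= mu * (sC * (b ^+ 2 - a ^+ 2 + c ^+ 2)).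
    by apply: mulr_ge0 (ltW mu0) (mulr_ge0 sC0 (addr_ge0 _ (sqr_ge0 _))); rewrite subr_ge0.
  have t3 : 0 <= (sA - sC) ^+ 2 by rewrite sqr_ge0.
  have t4 : 0 <= sB ^+ 2 by rewrite sqr_ge0.
  have t5 : 0 <= sB * (b ^+ 2 * mu) by apply: mulr_ge0 sB0 (mulr_ge0 (sqr_ge0 _) (ltW mu0)).
  have t6 : 0 <= sB * (sA + sC + a ^+ 2 * mu + c ^+ 2 * mu) 
    by exact: mulr_ge0 sB0 (addr_ge0 (addr_ge0 (addr_ge0 sA0 sC0)
      (mulr_ge0 (sqr_ge0 _) (ltW mu0))) (mulr_ge0 (sqr_ge0 _) (ltW mu0))).
  lra.
have ac0 : 0 < (a * c) ^+ 2 by rewrite exprn_gt0 // mulr_gt0.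
rewrite -(ler_pM2l ac0).
have -> : (a * c) ^+ 2 * (mu ^+ 2 * (9 * b ^+ 2 - 4)) = mu ^+ 2 * ((3 * a * b * c) ^+ 2 - 4 * a ^+ 2 * c ^+ 2) by ring.
rewrite -E; have -> : (a * c) ^+ 2 * b ^+ 2 = (a * b * c) ^+ 2 by ring.
by apply: le_trans low; rewrite le_eqVlt; apply/orP; left; apply/eqP; ring.
Qed.

Lemma corner_bound mu x s : irrat x -> 0 < mu -> valid x s -> good mu x s -> good mu x (step x s) ->
  lab_a s <= third x s -> lab_b s <= third x s -> lab_c s <= third x s ->
  mu ^+ 2 * (9 * (third x s)%:~R ^+ 2 - 4) <= (third x s)%:~R ^+ 2.
Proof.
move=> irr mu0 vs g1 g2.
have [tA|tB] := boolP (turnA x s).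
  by rewrite /third tA => ab _ cb; apply: (@corner_bound_A mu x s).
have vm := valid_mir vs; have gm := good_mir g1; have gm2 := good_mir g2.
have tm : turnA (- x) (mir s) by rewrite turnA_mir.
rewrite -step_mir // in gm2.
by rewrite /third (negbTE tB) => _ bb cb; exact: (corner_bound_A mu0 vm gm gm2 tm bb cb).
Qed.
End Fan.

(** * Flipping the triangulation *)

(** The label crossed at every other step is [lab_b s] if [s] was reached by an
    A-turn and [lab_a s] if it was reached by a B-turn; these are the edges that
    get flipped. *)
Definition flipA s := State (3 * lab_a s * lab_c s - lab_b s) (lab_a s) (lab_c s) (v1 s) (v2 s).
Definition flipB s := State (lab_b s) (3 * lab_b s * lab_c s - lab_a s) (lab_c s) (v1 s) (v2 s).
Definition flip (b : bool) s := if b then flipA s else flipB s.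

Lemma mirK s : mir (mir s) = s.
Proof.
by case: s => a b c [p1 q1] [p2 q2]; rewrite /mir /mirv /= !opprK.
Qed.

Lemma wf_flipA s : wf_state s -> wf_state (flipA s).
Proof.
move=> ws; have [mk o h1 h2] := ws; split=> //=.
- rewrite (_ : 3 * lab_a s * lab_c s - lab_b s = 3 * lab_c s * lab_a s - lab_b s); last by ring.
  by do 2 apply: markovz_rot; apply/markovz_swap/markovz_mut/markovz_rot/markovz_rot.
- rewrite (_ : _ + _ = lab_c s * (3 * lab_a s * (v1 s).1) - (lab_b s * (v1 s).1 - lab_a s * (v2 s).1)); last by ring.
  by rewrite rpredB ?dvdz_mulr ?(markovz_dvd mk).
- rewrite (_ : _ + _ = lab_c s * (3 * lab_a s * (v1 s).2) - (lab_b s * (v1 s).2 - lab_a s * (v2 s).2)); last by ring.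
  by rewrite rpredB ?dvdz_mulr ?(markovz_dvd mk).
Qed.

Lemma wf_flipB s : wf_state s -> wf_state (flipB s).
Proof. by move=> ws; rewrite -[flipB s]mirK; apply/wf_mir/(wf_flipA (wf_mir ws)). Qed.

(** The flip replaces the edge of label [b] from the apex to [v2] by the other diagonal of its
    quadrilateral, from [v1] to the apex of [stepB s]. *)
Lemma apex_flipA s : wf_state s -> apex (flipA s) = apex (stepB s).
Proof.
move=> ws; have [e1 e2] := apexE ws; have [f1 f2] := apexE (wf_stepB ws).
have [[_ b0 _ E] _ _ _] := ws.
have key w4 w5 y z : lab_c s * w4 = lab_b s * y - lab_a s * z -> lab_b s * w5 = lab_a s * w4 - lab_c s * z ->
    lab_c s * w5 = lab_a s * y - (3 * lab_a s * lab_c s - lab_b s) * z.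
  move=> g1 g2; apply: (mulfI (lt0r_neq0 b0)).
  transitivity (lab_c s * (lab_b s * w5)); first by ring.
  rewrite g2; transitivity (lab_a s * (lab_c s * w4) - lab_c s ^+ 2 * z); first by ring.
  rewrite g1; transitivity (lab_a s * lab_b s * y - (lab_a s ^+ 2 + lab_b s ^+ 2 + lab_c s ^+ 2) * z + lab_b s ^+ 2 * z); first by ring.
  by rewrite E; ring.
by apply: apex_unique; [exact: wf_flipA | apply: key e1 f1 | apply: key e2 f2].
Qed.

Lemma apex_flipAA s : wf_state s -> apex (stepA (flipA s)) = apex s.
Proof.
move=> ws; have [e1 e2] := apexE ws; have [f1 f2] := apexE (wf_stepB ws).
have [[_ b0 _ E] _ _ _] := ws.
have key w4 w5 y z : lab_c s * w4 = lab_b s * y - lab_a s * z -> lab_b s * w5 = lab_a s * w4 - lab_c s * z ->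
    (3 * lab_a s * lab_c s - lab_b s) * w4 = lab_c s * y - lab_a s * - w5.
  move=> g1 g2; apply: (mulfI (lt0r_neq0 b0)).
  transitivity (3 * lab_a s * lab_b s * lab_c s * w4 - lab_b s ^+ 2 * w4); first by ring.
  rewrite -E; transitivity (lab_a s ^+ 2 * w4 + lab_c s * (lab_c s * w4)); first by ring.
  rewrite g1; transitivity (lab_c s * lab_b s * y + lab_a s * (lab_a s * w4 - lab_c s * z)); first by ring.
  by rewrite -g2; ring.
apply: apex_unique; first exact/wf_stepA/wf_flipA.
- by rewrite /stepA apex_flipA //=; apply: key e1 f1.
- by rewrite /stepA apex_flipA //=; apply: key e2 f2.
Qed.

(** * Paths in the flipped triangulation *)

Section Sim.
Variables (R : realType) (mu x : R).
Hypothesis irr : irrat x.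

Lemma valid_flipA y s : @valid R y s -> valid y (flipA s).
Proof. by case=> ws *; split=> //; apply: wf_flipA. Qed.

Lemma valid_flipB y s : @valid R y s -> valid y (flipB s).
Proof. by case=> ws *; split=> //; apply: wf_flipB. Qed.

(** Crossing the quadrilateral takes two steps before the flip. After it, two B-turns become one
    step cutting off a corner opposite to the new diagonal, and a B-turn followed by an A-turn
    becomes an A-turn followed by a B-turn. *)
Lemma sim_A (y : R) s : irrat y -> valid y s -> ~~ turnA y s ->
  let s1 := step y s in
  (exists m, (0 < m)%N /\ track y (flipA s) m = flip (turnA y s1) (step y s1)) /\
  (~~ turnA y s1 -> third y (flipA s) = 3 * lab_a s * lab_c s - lab_b s).
Proof.
move=> irry vs tB; have [ws _ _ _ _] := vs.
have s1E : step y s = stepB s by rewrite /step (negbTE tB).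
have tE : turnA y (flipA s) = turnA y (stepB s) by rewrite /turnA apex_flipA.
rewrite s1E /third tE; split; last by move/negbTE ->.
have [tA|tnA] := boolP (turnA y (stepB s)).
  exists 2; split=> //=; rewrite {2}/step tE tA.
  have tE2 : turnA y (stepA (flipA s)) = false.
    by rewrite /turnA apex_flipAA //; apply: negbTE.
  rewrite /step tE2 tA /flipA /stepB apex_flipAA // [stepA (flipA s)]/stepA apex_flipA //=.
exists 1; split=> //=; rewrite /step tE (negbTE tnA) /flipB /= {1}/stepB apex_flipA //=.
by congr State; ring.
Qed.

Lemma sim_B s : valid x s -> turnA x s ->
  let s1 := step x s in
  (exists m, (0 < m)%N /\ track x (flipB s) m = flip (turnA x s1) (step x s1)) /\
  (turnA x s1 -> third x (flipB s) = 3 * lab_b s * lab_c s - lab_a s).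
Proof.
move=> vs tA s1; have vm := valid_mir vs; have irrm := irratN irr.
have vs1 : valid x s1 by exact: valid_step.
have [|[m [m0 mE]] h] := sim_A irrm vm; first by rewrite turnA_mir // tA.
have vf := valid_flipB vs.
rewrite step_mir // turnA_mir // in mE h; rewrite step_mir // in mE.
rewrite -/s1 in mE h.
have fmE : flipA (mir s) = mir (flipB s) by [].
split; last first.
  by move=> t; move: h; rewrite t fmE third_mir // => ->.
exists m; split=> //; rewrite -[LHS]mirK -track_mir // -fmE mE.
by case: (turnA x s1); rewrite /= -[RHS]mirK.
Qed.

Lemma sim b s : valid x s -> turnA x s = ~~ b ->
  let s1 := step x s in
  (exists m, (0 < m)%N /\ track x (flip b s) m = flip (turnA x s1) (step x s1)) /\
  (turnA x s1 = ~~ b -> third x (flip b s) =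
     if b then 3 * lab_a s * lab_c s - lab_b s else 3 * lab_b s * lab_c s - lab_a s).
Proof.
case: b => vs t; rewrite /flip.
  by have [h1 h2] := sim_A irr vs (negbT t); split=> // t1; apply: h2; rewrite t1.
by have [h1 h2] := sim_B vs t.
Qed.

Lemma third_step2 s : turnA x (step x s) = ~~ turnA x s ->
  [/\ lab_a (step x (step x s)) = lab_a s, lab_b (step x (step x s)) = lab_b s,
     lab_c (step x (step x s)) = lab_c s & third x (step x s) = third x s].
Proof.
rewrite /third {1}/step => t; rewrite {2 5 8}/step.
case: ifP t => tA t; rewrite /step tA /= ?t /=; split=> //.
Qed.

Definition labels_le M s := [/\ lab_a s <= M, lab_b s <= M & lab_c s <= M].

Lemma labels_le_step M s : labels_le M s -> labels_le M (step x s).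
Proof. by case=> h1 h2 h3; rewrite /step; case: ifP => _; split. Qed.

Lemma labels_le_track M s n : labels_le M s -> labels_le M (track x s n).
Proof. by move=> h; elim: n => //= n; apply: labels_le_step. Qed.

Hypotheses (mu0 : 0 < mu) (mu3 : 1 < 3 * mu).

(** The first of two equal turns creates one invariant; it forces the third turn to be opposite, and
    that turn creates the other invariant. *)
Lemma double_turn s : valid x s -> good mu x s -> good mu x (step x s) ->
  good mu x (step x (step x s)) -> turnA x (step x s) = turnA x s ->
  let s3 := step x (step x (step x s)) in invA x s3 /\ invB x s3.
Proof.
move=> vs g0 g1 g2 t.
have aux (y : R) r : irrat y -> valid y r -> good mu y r -> good mu y (step y r) ->
    good mu y (step y (step y r)) -> turnA y r -> turnA y (step y r) ->
    let r3 := step y (step y (step y r)) in invA y r3 /\ invB y r3.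
  move=> irry vr h0 h1 h2 t1 t2; have ia := invA_fresh mu3 vr h0 t1.
  have vr1 := valid_step irry vr; have vr2 := valid_step irry vr1.
  split; first exact: invA_block.
  by apply: (invB_fresh mu3) => //; rewrite (invA_noAA vr1 ia t2).
case tA: (turnA x s) t => t; first exact: aux.
have vs1 := valid_step irr vs; have vs2 := valid_step irr vs1.
have H := aux (- x) (mir s) (irratN irr) (valid_mir vs).
rewrite !step_mir // !turnA_mir // t tA in H.
have [i1] := H (good_mir g0) (good_mir g1) (good_mir g2) isT isT.
by rewrite /invB opprK mirK.
Qed.

Hypothesis goodE : forall s, valid x s -> exists N, forall n, (N <= n)%N -> good mu x (track x s n).

Definition alternates := exists s, [/\ valid x s,
  forall n, turnA x (track x s n) = ~~ odd n, lab_a s <= lab_b s & lab_c s <= lab_b s].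

(** Induction on a bound for K - M, where [M] is a largest label opposite to infinitely many cut
    corners: each flip raises [M], while [corner_bound] keeps it below [K]. *)
Lemma stage (K : nat) :
  (forall M : int, 0 < M -> mu ^+ 2 * (9 * M%:~R ^+ 2 - 4) <= M%:~R ^+ 2 -> M < Posz K) ->
  forall n s M, valid x s -> labels_le M s -> Posz K <= M + Posz n ->
  (forall N, exists2 k, (N <= k)%N & third x (track x s k) = M) -> alternates.
Proof.
move=> HK; elim=> [|n IH] s M vs le KM ev; have [N gN] := goodE vs;
  have v k := valid_track k irr vs.
  have [k Nk kM] := ev N.
  have [l1 l2 l3] := labels_le_track k le.
  have M0 : 0 < M by have [[[a0 _ _ _] _ _ _] _ _ _ _] := v k; lia.
  have := corner_bound irr mu0 (v k) (gN k Nk) (gN k.+1 (leqW Nk)).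
  rewrite kM => /(_ l1 l2 l3) /(HK _ M0); lia.
have [[N0 alt]|nalt] := pselect (exists N0, forall n, (N0 <= n)%N -> turnA x (track x s n.+1) = ~~ turnA x (track x s n)).
  have alt' r k : (N0 <= k)%N -> r = track x s k -> turnA x r -> forall m, turnA x (track x r m) = ~~ odd m.
    move=> Nk rE tr; elim=> [|m IHm] //.
    by rewrite rE -trackD addSn alt ?(leq_trans Nk (leq_addl _ _)) // trackD -rE IHm.
  have [k Nk kM] := ev N0; have [l1 l2 l3] := labels_le_track k le.
  have [tA|tB] := boolP (turnA x (track x s k)).
    move: kM; rewrite /third tA => kM; exists (track x s k); split; rewrite ?kM //.
    exact: (alt' _ k).
  move: kM; rewrite /third (negbTE tB) => kM.
  have sE : track x s k.+1 = stepB (track x s k) by rewrite trackS /step (negbTE tB).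
  (* The state sought must turn A next; one step later it does, and the largest label has become
     [lab_b]. *)
  exists (track x s k.+1); split=> //.
  - by apply: (alt' _ k.+1) => //; [apply: leqW | rewrite alt // tB].
  - by rewrite sE /= kM.
  - by rewrite sE /= kM.
have dbl N1 : exists2 k, (N1 <= k)%N & turnA x (track x s k.+1) = turnA x (track x s k).
  apply: contrapT => no; apply: nalt; exists N1 => k Nk.
  apply/eqP; rewrite -[_ == _]negbK; apply/negP => e; apply: no; exists k => //.
  by move: e; case: (turnA x _); case: (turnA x _).
(* One double turn in the good range makes all later turns fall into blocks AB and BA. *)
have [k Nk kd] := dbl N.
set s0 := track x s k.+3; have vs0 : valid x s0 := v _.
have gs0 m : good mu x (track x s0 m).
  by rewrite -trackD; apply: gN; rewrite (leq_trans Nk) // (leq_trans _ (leq_addl _ _)) // -addn3 leq_addr.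
have [ia ib] : invA x s0 /\ invB x s0.
  by apply: double_turn; [exact: v | exact: gN | exact: (gN k.+1 (leqW Nk)) | exact: (gN k.+2 (leqW (leqW Nk))) | ].
have bl := blocks mu3 irr vs0 gs0 ia ib.
pose z j := track x s0 j.*2; pose w j := track x s0 (j.*2).+1.
have lab j : [/\ lab_a (z j) = lab_a s0, lab_b (z j) = lab_b s0 & lab_c (z j) = lab_c s0].
  elim: j => [|j [h1 h2 h3]] //.
  have [t _ _] := bl j; have [g1 g2 g3 _] := third_step2 t.
  by split; rewrite /z doubleS ?g1 ?g2 ?g3.
have third_ab m : third x (track x s0 m) = lab_a s0 \/ third x (track x s0 m) = lab_b s0.
  have tz j : third x (z j) = lab_a s0 \/ third x (z j) = lab_b s0.
    by have [g1 g2 _] := lab j; rewrite /third g1 g2; case: ifP; [right | left].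
  rewrite -[m]odd_double_half; case: (odd m) => /=; last exact: tz.
  by have [t _ _] := bl m./2; have [_ _ _ g] := third_step2 t; rewrite g; apply: tz.
have [l1 l2 l3] : labels_le M s0 by apply: labels_le_track.
have Mab : lab_a s0 = M \/ lab_b s0 = M.
  have [m mk mM] := ev k.+3; have := third_ab (m - k.+3)%N.
  by rewrite /s0 -trackD subnK // mM => -[]; [left | right].
(* Label of the new diagonal. One of [lab_a], [lab_b] is [M] and [lab_c] is at most [M], so it
   exceeds [M]. *)
pose c' := 3 * lab_a s0 * lab_b s0 - lab_c s0.
have [[[a0 b0 c0 E] _ _ _] _ _ _ _] := vs0.
have Mc : M < c'.
  have [aM|bM] := Mab.
    have : lab_a s0 * 1 <= lab_a s0 * lab_b s0 by rewrite ler_pM2l // -gtz0_ge1.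
    by rewrite /c'; lia.
  have : 1 * lab_b s0 <= lab_a s0 * lab_b s0 by rewrite ler_pM2r // -gtz0_ge1.
  by rewrite /c'; lia.
(* [b j] is the first turn of block j, and [phi j] the flipped state in the middle of that block. *)
pose b j := turnA x (z j); pose phi j := flip (b j) (w j).
have wE j : w j = if b j then stepA (z j) else stepB (z j) by rewrite /w trackS.
have vphi j : valid x (phi j).
  by rewrite /phi /flip; case: (b j); [apply: valid_flipA | apply: valid_flipB]; apply: valid_track.
have lphi j : labels_le c' (phi j).
  have [g1 g2 g3] := lab j; rewrite /phi wE; case: (b j); split; rewrite /= ?g1 ?g2 ?g3 /c'; lia.
have simj j : (exists m, (0 < m)%N /\ track x (phi j) m = phi j.+1) /\
    (b j.+1 = ~~ b j -> third x (phi j) = c').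
  have [t _ _] := bl j; have [h1 h2] := sim (valid_track _ irr vs0) t.
  split; first exact: h1.
  move=> e; rewrite /phi h2 // -/(w j) wE /b.
  have [g1 g2 g3] := lab j.
  by case: (turnA x (z j)); rewrite /= ?g1 ?g2 ?g3 /c'; ring.
have reach j : exists2 m, (j <= m)%N & track x (phi 0%N) m = phi j.
  elim: j => [|j [m jm mE]]; first by exists 0%N.
  have [[m' [m0 m'E]] _] := simj j.
  by exists (m' + m)%N; [rewrite -addn1 addnC leq_add | rewrite trackD mE].
apply: (IH (phi 0%N) c') => //; first by lia.
move=> N1; have [k1 Nk1 kd1] := dbl (k.+3 + N1.*2)%N.
pose m := (k1 - k.+3)%N; have mE : (m + k.+3)%N = k1 by rewrite subnK // (leq_trans _ Nk1) // leq_addr.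
have kd2 : turnA x (track x s0 m.+1) = turnA x (track x s0 m) by rewrite /s0 -!trackD addSn mE.
have mN : (N1.*2 <= m)%N by rewrite leq_subRL // (leq_trans _ Nk1) // leq_addr.
have [m1 jm m1E] := reach m./2; exists m1.
  by apply: leq_trans jm; rewrite -[N1]doubleK half_leq.
rewrite m1E; have [_ h] := simj m./2; apply: h.
(* A double turn cannot lie inside a block, so it joins two blocks of different kinds, where the
   flipped path cuts off a corner opposite to c'. *)
move: kd2; rewrite -[in LHS](odd_double_half m) -[in RHS](odd_double_half m).
have [t _ _] := bl m./2.
case: (odd m); rewrite /= ?add1n ?add0n.
  by rewrite t /b /z doubleS.
by rewrite t; case: (turnA x _).
Qed.
End Sim.

(** * Alternating cutting sequences *)

Section Alternate.
Variable R : realType.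

(** Y (n+1) - r Y n is multiplied by [rho] > 1 at each step; boundedness forces it to vanish. *)
Lemma bounded_recurrence (Y : nat -> R) (K r rho : R) :
  (forall n, 0 < Y n <= K) -> r * rho = 1 -> 0 < r -> 1 < rho ->
  (forall n, Y n.+2 = (r + rho) * Y n.+1 - Y n) -> Y 1%N = r * Y 0%N.
Proof.
move=> bd rr r0 rho1 rec.
have Zn n : Y n.+1 - r * Y n = rho ^+ n * (Y 1%N - r * Y 0%N).
  elim: n => [|n IH]; first by rewrite expr0 mul1r.
  rewrite exprS -mulrA -IH rec -[Y n in LHS]mul1r -rr; ring.
have r1 : r < 1 by rewrite -(ltr_pM2r (x := rho)) ?rr ?mul1r // (lt_trans _ rho1).
have bern n : 1 + n%:R * (rho - 1) <= rho ^+ n.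
  elim: n => [|n IH]; first by rewrite expr0 mul0r addr0.
  rewrite exprS -natr1; have i1 : rho * (1 + n%:R * (rho - 1)) <= rho * rho ^+ n.
    by rewrite ler_pM2l // (lt_trans _ rho1).
  have i2 : 0 <= n%:R * (rho - 1) ^+ 2 by rewrite mulr_ge0 ?ler0n ?sqr_ge0.
  lra.
apply: contrapT => /eqP; rewrite -subr_eq0 -normr_gt0 => z0.
set z := `|_| in z0.
have Zb n : rho ^+ n * z <= K + K.
  have -> : rho ^+ n * z = `|Y n.+1 - r * Y n|.
    by rewrite Zn normrM ger0_norm // exprn_ge0 // ltW // (lt_trans _ rho1).
  have /andP[y0 y1] := bd n; have /andP[y0' y1'] := bd n.+1.
  by rewrite ler_norml; apply/andP; split; nra.
have d0 : 0 < (rho - 1) * z by rewrite mulr_gt0 // subr_gt0.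
have K0 : 0 <= (K + K) / ((rho - 1) * z).
  by have /andP[y0 y1] := bd 0%N; rewrite divr_ge0 ?(ltW d0) // addr_ge0 //; apply: le_trans y1; apply: ltW.
have := archi_boundP K0; set n := Num.bound _; rewrite ltr_pdivrMr // => lt.
have := Zb n; have := bern n; have : 0 <= z by exact: ltW.
by nra.
Qed.

(** On an alternating path the successive [v2] are consecutive vertices on one side of the strip. *)
Lemma offset_v2_recurrence (x : R) s : wf_state s ->
  offset x (v2 (stepA (stepB (stepA s)))) =
  3 * (lab_b s)%:~R * offset x (v2 (stepA s)) - offset x (v2 s).
Proof.
move=> ws; have [_ f2] := apexR x ws; have w1 := wf_stepA ws.
have w2 := wf_stepB w1; have [_ g2] := apexR x w2.
have y5 := offset_apex_stepA x ws.
have [mk _ _ _] := ws; have [a0 b0 c0 E] := markovzR R mk.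
rewrite [v2 (stepA (stepB _))]/= [v2 (stepA s)]/= !offsetN.
rewrite [lab_c _]/= [lab_b (stepB _)]/= [lab_a (stepB _)]/= [v1 _]/= [v2 _]/= y5 offsetN in g2.
apply: (mulfI (lt0r_neq0 c0)); rewrite mulrN g2 /fan.
apply: (mulfI (lt0r_neq0 c0)).
transitivity (- (lab_b s)%:~R * ((3 * (lab_b s)%:~R * (lab_c s)%:~R - (lab_a s)%:~R) * offset x (v1 s) - (lab_b s)%:~R * offset x (v2 s))
   - (lab_a s)%:~R * ((lab_c s)%:~R * offset x (apex s))).
  by field; exact: lt0r_neq0.
transitivity (- 3 * (lab_b s)%:~R * (lab_c s)%:~R * ((lab_c s)%:~R * offset x (apex s)) - (lab_c s)%:~R ^+ 2 * offset x (v2 s)); last by ring.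
rewrite f2.
have -> : (lab_c s)%:~R ^+ 2 = 3 * (lab_a s)%:~R * (lab_b s)%:~R * (lab_c s)%:~R - (lab_a s)%:~R ^+ 2 - (lab_b s)%:~R ^+ 2 :> R.
  by rewrite -E; ring.
ring.
Qed.

(** The offsets of the successive [v2] are positive and at most c = q1 y2 - q2 y1, as q1 >= 1; a
    bounded solution decays with the smaller eigenvalue. *)
Lemma alternating_ratio (x : R) s : irrat x -> valid x s ->
  (forall n, turnA x (track x s n) = ~~ odd n) ->
  - offset x (apex s) = (3 * (lab_b s)%:~R - sqrt_disc R (lab_b s)) / 2 * offset x (v2 s).
Proof.
move=> irr vs alt.
have st n : track x s n.*2.+1 = stepA (track x s n.*2) /\
    track x s n.*2.+2 = stepB (stepA (track x s n.*2)).
  have t0 := alt n.*2; have t1 := alt n.*2.+1; rewrite /= odd_double /= in t0 t1.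
  have e : track x s n.*2.+1 = stepA (track x s n.*2) by rewrite trackS /step t0.
  by split=> //; rewrite trackS /step t1 e.
have lab n : lab_b (track x s n.*2) = lab_b s /\ lab_c (track x s n.*2) = lab_c s.
  elim: n => [|n [h1 h2]] //; have [_ e] := st n.
  by rewrite doubleS e /= h1 h2.
have v n := valid_track n irr vs.
pose Y n := offset x (v2 (track x s n.*2)).
have [ws _ _ _ _] := vs; have [[_ b0 _ _] _ _ _] := ws.
have D0 := sqrt_disc_gt0 R b0; have D2 := sqrt_disc_sqr R b0; have D3 := sqrt_disc_lt R b0.
set D := sqrt_disc R (lab_b s) in D0 D2 D3 *; set B : R := (lab_b s)%:~R in D0 D2 D3 *.
have B1 : 1 <= B by rewrite ler1z -gtz0_ge1.
have <- : Y 1%N = - offset x (apex s).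
  by have [_ e] := st 0%N; rewrite /Y e /= offsetN.
apply: (@bounded_recurrence Y (lab_c s)%:~R _ ((3 * B + D) / 2)).
- move=> n; have [[_ o _ _] q1 q2 y1 y2] := v n.*2.
  apply/andP; split; first exact: y2.
  have [_ <-] := lab n; rewrite -o (vdetR x).
  have i1 : 1 * offset x (v2 (track x s n.*2)) <= (v1 (track x s n.*2)).2%:~R * offset x (v2 (track x s n.*2)).
    by rewrite ler_pM2r // ler1z -gtz0_ge1.
  have i2 : 0 <= - (v2 (track x s n.*2)).2%:~R * offset x (v1 (track x s n.*2)).
    by rewrite mulr_ge0 ?(ltW y1) // oppr_ge0 lerz0 ltW.
  by rewrite /Y; lra.
- by lra.
- by lra.
- by nra.
- move=> n; have [e1 e2] := st n; have [e3 _] := st n.+1.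
  have [wn _ _ _ _] := v n.*2; have := offset_v2_recurrence x wn.
  have [-> _] := lab n; rewrite -/B -e2 -doubleS -e3 => h.
  have -> : Y n.+2 = offset x (v2 (track x s (n.+1).*2.+1)).
    by have [e4 e5] := st n.+1; rewrite /Y doubleS e5 e4.
  rewrite h; have -> : offset x (v2 (stepA (track x s n.*2))) = Y n.+1.
    by rewrite /Y doubleS e2.
  by rewrite /Y; field.
Qed.

(** An integral matrix of determinant 1 sends v2, -v1 and -apex to (1, 0), (P2, c) and (k, b), the
    standard position of the strip; [X] is the image of [x]. *)
Lemma alternating_markov (x : R) s : irrat x -> valid x s ->
  (forall n, turnA x (track x s n) = ~~ odd n) ->
  exists p1 p2 k l (X : R), markov_data (lab_c s) (lab_a s) (lab_b s) p1 p2 k l X /\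
    equivalent_reals X x.
Proof.
move=> irr vs alt; have ratio := alternating_ratio irr vs alt.
have [ws q1 q2 y1 y2] := vs; have [mk o h1 h2] := ws.
have [a0 b0 c0 E] := mk; have [f1 f2] := apexE ws.
have [_ o4 _ _] := wf_stepB ws; rewrite /= in o4.
have mk' : markovz (lab_c s) (lab_a s) (lab_b s) by do 2 apply: markovz_rot.
(* The determinants of the apex and of [v1] with [v2] are the coprime labels [b] and [c], so [v2] is
   primitive. *)
have /coprimezP[[u u'] /= uu] := markovz_coprime (markovz_rot mk).
set p := (v2 s).1 in o o4 f1 h1; set q := (v2 s).2 in o o4 f2 h2 q2.
have [e [f efE]] : exists e f, e * p + f * q = 1.
  exists (- (u * (apex s).2 + u' * (v1 s).2)), (u * (apex s).1 + u' * (v1 s).1).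
  by rewrite -uu -o4 -o /vdet /= -/p -/q; ring.
pose P2 := - (e * (v1 s).1 + f * (v1 s).2).
have /dvdzP[P1 P1E] : (lab_c s %| P2 * lab_a s - lab_b s)%Z.
  have -> : P2 * lab_a s - lab_b s = - e * (lab_a s * (v1 s).1 + lab_b s * p) - f * (lab_a s * (v1 s).2 + lab_b s * q).
    by rewrite -[lab_b s in LHS]mulr1 -efE /P2; ring.
  by rewrite rpredB ?dvdz_mull.
have bez : P2 * lab_a s - P1 * lab_c s = lab_b s by rewrite -P1E; ring.
have [k [l [Hk Hl]]] := markovz_residue mk' bez.
have kE : k = - (e * (apex s).1 + f * (apex s).2).
  apply: (mulfI (lt0r_neq0 c0)); rewrite Hk.
  transitivity (- (e * (lab_c s * (apex s).1) + f * (lab_c s * (apex s).2))); last by ring.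
  rewrite f1 f2; transitivity (lab_b s * P2 + lab_a s * (e * p + f * q)); last by rewrite /P2; ring.
  by rewrite efE mulr1.
pose Z : R := p%:~R - q%:~R * x.
have ZE : Z = - offset x (v2 s) by rewrite /Z /offset; ring.
have Z0 : Z != 0 by rewrite ZE oppr_eq0 lt0r_neq0.
pose X : R := (e%:~R * x + f%:~R) / Z.
have efR : e%:~R * p%:~R + f%:~R * q%:~R = 1 :> R by rewrite -!intrM -intrD efE.
have o4R : (apex s).1%:~R * q%:~R - (apex s).2%:~R * p%:~R = (lab_b s)%:~R :> R.
  by rewrite -!intrM -intrB -o4.
exists P1, P2, k, l, X; split.
  split=> //; apply: (mulIf Z0).
  transitivity (2 * (lab_b s)%:~R * (e%:~R * x + f%:~R)); first by rewrite /X; field.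
  transitivity (2 * k%:~R * Z + 2 * (- offset x (apex s))).
    rewrite kE rmorphN rmorphD !rmorphM /= -o4R /offset /Z.
    transitivity (2 * ((e%:~R * p%:~R + f%:~R * q%:~R) * ((apex s).1%:~R - (apex s).2%:~R * x)
      - (e%:~R * (apex s).1%:~R + f%:~R * (apex s).2%:~R) * (p%:~R - q%:~R * x)) : R); first by ring.
    by rewrite efR; ring.
  by rewrite ratio -[offset x (v2 s)]opprK -ZE; field.
exists p, (- f), q, e; split.
- by rewrite (_ : p * e - - f * q = 1) // -efE; ring.
- have -> : q%:~R * X + e%:~R = (e%:~R * p%:~R + f%:~R * q%:~R) / Z.
    by rewrite /X /Z; field.
  by rewrite efR div1r invr_eq0.
- have -> : q%:~R * X + e%:~R = (e%:~R * p%:~R + f%:~R * q%:~R) / Z.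
    by rewrite /X /Z; field.
  rewrite efR rmorphN /=; have -> : p%:~R * X - f%:~R = x * (e%:~R * p%:~R + f%:~R * q%:~R) / Z.
    by rewrite /X /Z; field.
  by rewrite efR; field; exact: Z0.
Qed.

Lemma equivalent_realsN (X x : R) : equivalent_reals X (- x) -> equivalent_reals X x.
Proof.
case=> al [be [ga [de [d n e]]]]; exists (- al), (- be), ga, de; split=> //.
- by rewrite -d -normrN; congr `|_|; ring.
- by rewrite -[LHS]opprK e !rmorphN /=; field.
Qed.

(** If the two smaller labels come out in the wrong order, the mirror image after one step gives the
    other order. *)
Lemma alternates_markov (x : R) : irrat x -> alternates x ->
  exists a b c p1 p2 k l (X : R), [/\ markov_data a b c p1 p2 k l X,
    a <= b <= c & equivalent_reals X x].
Proof.
move=> irr [s [vs alt ab cb]].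
have [ca|ac] := leP (lab_c s) (lab_a s).
  have [p1 [p2 [k [l [X [d eq]]]]]] := alternating_markov irr vs alt.
  by exists (lab_c s), (lab_a s), (lab_b s), p1, p2, k, l, X; split=> //; rewrite ca ab.
have vs1 := valid_step irr vs; have := alt 0%N; rewrite /= => t0.
have alt' n : turnA (- x) (track (- x) (mir (step x s)) n) = ~~ odd n.
  rewrite track_mir // turnA_mir //; last exact: valid_track.
  by have := alt n.+1; rewrite -addn1 trackD /= addn1 /= => ->; rewrite negbK.
have [p1 [p2 [k [l [X [d eq]]]]]] := alternating_markov (irratN irr) (valid_mir vs1) alt'.
rewrite /step t0 /= in d.
exists (lab_a s), (lab_c s), (lab_b s), p1, p2, k, l, X; split=> //.
  by rewrite (ltW ac) cb.
exact: equivalent_realsN.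
Qed.
End Alternate.

(** * Existence and uniqueness of the triple *)

Section Main.
Variable R : realType.

Lemma irrational_irrat (x : R) : irrational x -> irrat x.
Proof.
move=> irr m n h; apply: contrapT => /eqP m0; apply: irr.
exists ((- n)%:~R / m%:~R) => //.
rewrite fmorph_div /= !ratr_int; apply: (mulIf (_ : m%:~R != 0 :> R)); first by rewrite intr_eq0.
rewrite divfK ?intr_eq0 // rmorphN /=; apply/eqP; rewrite -subr_eq0 -[X in _ == X]oppr0 -h.
by apply/eqP; ring.
Qed.

Lemma exists_alternates (x : R) lambda : irrat x -> 0 < lambda -> lambda < 3 ->
  finite_set (good_fractions x lambda) -> alternates x.
Proof.
move=> irr lam0 lam3 fin.
pose mu := lambda^-1.
have mu0 : 0 < mu by rewrite invr_gt0.
have mu3 : 1 < 3 * mu by rewrite ltr_pdivlMr // mul1r.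
pose n := Num.floor x.
have /andP[n1 n2] : n%:~R <= x < (n + 1)%:~R by exact: floor_itv.
(* The path starts in the triangulation of the triple (1, 1, 1), at the edge between the integers
   around [x]. *)
pose s := State 1 1 1 (n, 1) (- (n + 1), -1).
have vs : valid x s.
  split=> //=.
  - by split; rewrite ?dvd1z // /vdet /=; ring.
  - have : offset x (n, 1) != 0 by apply: offset_neq0.
    by rewrite lt_def => ->; rewrite /offset /= mul1r subr_ge0.
  - by rewrite /offset /= !rmorphN /= mulN1r opprK addrC subr_gt0.
have goodE t : valid x t -> exists N, forall n, (N <= n)%N -> good mu x (track x t n).
  exact: good_eventually.
(* The bound at a corner says M^2 <= [kap], which is finite because mu > 1/3. *)
pose kap := 4 * mu ^+ 2 / (9 * mu ^+ 2 - 1).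
have den : 0 < 9 * mu ^+ 2 - 1 by nra.
have kap0 : 0 <= kap by rewrite divr_ge0 // ?ltW // mulr_gt0 // exprn_gt0.
pose K := Num.bound kap; have KP : kap < K%:R := archi_boundP kap0.
have HK (M : int) : 0 < M -> mu ^+ 2 * (9 * M%:~R ^+ 2 - 4) <= M%:~R ^+ 2 -> M < Posz K.
  move=> M0 h; rewrite -(ltr_int R); apply: le_lt_trans KP.
  have M1 : 1 <= M%:~R :> R by rewrite ler1z -gtz0_ge1.
  rewrite ler_pdivlMr //; apply: (@le_trans _ _ (M%:~R ^+ 2 * (9 * mu ^+ 2 - 1))).
    by rewrite ler_pM2r // expr2 ler_peMl // ltW // (lt_le_trans _ M1).
  by lra.
have le1 : labels_le 1 s by split.
apply: (@stage R mu x irr mu0 mu3 goodE K HK K s 1 vs le1); first by lia.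
move=> N; exists N => //.
have [[[a0 b0 c0 _] _ _ _] _ _ _ _] := valid_track N irr vs.
have [l1 l2 l3] := labels_le_track x N le1.
by rewrite /third; case: ifP => _; apply/eqP; rewrite eq_le -gtz0_ge1 ?l1 ?l2 ?a0 ?b0.
Qed.

Lemma markov_data_triple a b c p1 p2 : markov_triple a b c -> markov_bezout a b c p1 p2 ->
  exists k l, markov_data (Posz a) (Posz b) (Posz c) p1 p2 k l (markov_irrational R a b c p2).
Proof.
case=> a0 b0 c0 E bez.
have mk : markovz (Posz a) (Posz b) (Posz c) by split=> //; lia.
have [k [l [Hk Hl]]] := markovz_residue mk bez.
exists k, l; split=> //.
have [aR bR cR _] := markovzR R mk.
have := congr1 (fun z : int => z%:~R : R) Hk; rewrite rmorphM rmorphD rmorphM /= => kR.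
rewrite /markov_irrational !pmulrn half_sqrt_disc //.
have -> : k%:~R = ((Posz c)%:~R * p2%:~R + (Posz b)%:~R) / (Posz a)%:~R :> R.
  by rewrite -kR mulrC mulKf // lt0r_neq0.
by field; rewrite !lt0r_neq0.
Qed.

Lemma markov_data_nat a b c p1 p2 k l (X : R) : markov_data a b c p1 p2 k l X ->
  [/\ markov_triple (absz a) (absz b) (absz c),
      markov_bezout (absz a) (absz b) (absz c) p1 p2 &
      X = markov_irrational R (absz a) (absz b) (absz c) p2].
Proof.
move=> d; have [mk bez Hk Hl Hx] := d; have [a0 b0 c0 E] := mk.
have aE := gtz0_abs a0; have bE := gtz0_abs b0; have cE := gtz0_abs c0.
have tr : markov_triple (absz a) (absz b) (absz c) by split; lia.
have bz : markov_bezout (absz a) (absz b) (absz c) p1 p2 by rewrite /markov_bezout aE bE cE.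
split=> //; have [k' [l' [_ _ Hk' _ Hx']]] := markov_data_triple tr bz.
rewrite aE bE cE in Hk' Hx'.
have kk : k = k' by apply: (mulfI (lt0r_neq0 a0)); rewrite Hk Hk'.
apply: (mulfI (_ : 2 * c%:~R != 0 :> R)); first by rewrite mulf_neq0 ?pnatr_eq0 ?intr_eq0 ?lt0r_neq0.
by rewrite Hx Hx' kk.
Qed.

(** The matrix is the adjugate of the first one times the second. *)
Lemma equivalent_reals_matrix (x1 x2 x : R) : equivalent_reals x1 x -> equivalent_reals x2 x ->
  exists (h11 h12 h21 h22 : int) (t : R), [/\ (h11 * h22 - h12 * h21) ^+ 2 = 1,
    h11%:~R * x2 + h12%:~R = t * x1 & h21%:~R * x2 + h22%:~R = t].
Proof.
case=> a1 [b1 [c1 [d1 [det1 n1 e1]]]] [a2 [b2 [c2 [d2 [det2 n2 e2]]]]].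
have sq (z : int) : `|z| = 1 -> z ^+ 2 = 1 by move=> h; rewrite -[z ^+ 2]real_normK ?num_real // h expr1n.
pose D := a1 * d1 - b1 * c1.
exists (d1 * a2 - b1 * c2), (d1 * b2 - b1 * d2), (a1 * c2 - c1 * a2), (a1 * d2 - c1 * b2).
exists (D%:~R * (c2%:~R * x2 + d2%:~R) / (c1%:~R * x1 + d1%:~R)).
have f1 : a1%:~R * x1 + b1%:~R = x * (c1%:~R * x1 + d1%:~R) by rewrite e1 divfK.
have f2 : a2%:~R * x2 + b2%:~R = x * (c2%:~R * x2 + d2%:~R) by rewrite e2 divfK.
split.
- transitivity ((a1 * d1 - b1 * c1) ^+ 2 * (a2 * d2 - b2 * c2) ^+ 2); first by ring.
  by rewrite !sq ?mulr1.
- apply: (mulIf n1); rewrite !rmorphB !rmorphM /=.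
  transitivity ((d1%:~R * (a2%:~R * x2 + b2%:~R) - b1%:~R * (c2%:~R * x2 + d2%:~R)) * (c1%:~R * x1 + d1%:~R)); first by ring.
  rewrite f2; transitivity ((c2%:~R * x2 + d2%:~R) * (d1%:~R * (x * (c1%:~R * x1 + d1%:~R)) - b1%:~R * (c1%:~R * x1 + d1%:~R))); first by ring.
  rewrite -f1; transitivity ((a1%:~R * d1%:~R - b1%:~R * c1%:~R) * (c2%:~R * x2 + d2%:~R) * x1); first by ring.
  by field.
- apply: (mulIf n1); rewrite !rmorphB !rmorphM /= divfK //.
  transitivity ((a1%:~R * (c2%:~R * x2 + d2%:~R) - c1%:~R * (a2%:~R * x2 + b2%:~R)) * (c1%:~R * x1 + d1%:~R)); first by ring.
  rewrite f2; transitivity ((c2%:~R * x2 + d2%:~R) * (a1%:~R * (c1%:~R * x1 + d1%:~R) - c1%:~R * (x * (c1%:~R * x1 + d1%:~R)))); first by ring.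
  by rewrite -f1; ring.
Qed.

(** Distinct [b], [b'] would be the two roots of one quadratic and add up to 3 a c, which exceeds 2
    c. *)
Lemma markovz_eq_sorted a b b' c : markovz a b c -> markovz a b' c ->
  b <= c -> b' <= c -> b = b'.
Proof.
move=> [a0 b0 c0 E] [_ b0' _ E'] bc bc'; apply/eqP; rewrite -subr_eq0.
have : (b - b') * (b + b' - 3 * a * c) = 0 by lia.
move/eqP; rewrite mulf_eq0 => /orP[//|/eqP e].
have : 1 * c <= a * c by rewrite ler_pM2r // -gtz0_ge1.
by lia.
Qed.

(** The comparison in both directions gives equal [c] and equal [a]; the Markov equation then
    determines the middle entry. *)
Lemma sorted_markov_triple_unique a b c p1 p2 a' b' c' p1' p2' (x : R) :
  sorted_markov_triple a b c -> sorted_markov_triple a' b' c' ->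
  markov_bezout a b c p1 p2 -> markov_bezout a' b' c' p1' p2' ->
  equivalent_reals (markov_irrational R a b c p2) x ->
  equivalent_reals (markov_irrational R a' b' c' p2') x ->
  (a, b, c) = (a', b', c').
Proof.
move=> [tr abc] [tr' abc'] bz bz' eq eq'.
have [k [l d]] := markov_data_triple tr bz; have [k' [l' d']] := markov_data_triple tr' bz'.
have [h11 [h12 [h21 [h22 [t [det g1 g2]]]]]] := equivalent_reals_matrix eq eq'.
have [i11 [i12 [i21 [i22 [t' [det' g1' g2']]]]]] := equivalent_reals_matrix eq' eq.
have [cc le] := markov_data_equiv_le d d' abc det g1 g2.
have [_ le'] := markov_data_equiv_le d' d abc' det' g1' g2'.
have [mk _ _ _ _] := d; have [mk' _ _ _ _] := d'.
have aa : Posz a = Posz a' by apply/eqP; rewrite eq_le le le'.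
have /andP[_ bc] := abc; have /andP[_ bc'] := abc'.
rewrite -aa -cc in mk'.
rewrite -[(b' <= c')%N]/(Posz b' <= Posz c') -cc in bc'.
by case: aa cc (markovz_eq_sorted mk mk' bc bc') => -> [->] [->].
Qed.
End Main.

Theorem mainTheorem1 (R : realType) :
  (forall (a b c : nat) (p1 p2 : int),
     markov_triple a b c -> markov_bezout a b c p1 p2 ->
     let x : R := markov_irrational R a b c p2 in
     let lambda0 : R := Num.sqrt (9 - 4 / c%:R ^+ 2) in
     infinite_set (good_fractions x lambda0) /\
     (forall lambda : R, lambda0 < lambda ->
        finite_set (good_fractions x lambda)))
  /\
  (forall x' : R, irrational x' ->
     (exists lambda : R,
        [/\ 0 < lambda, lambda < 3 & finite_set (good_fractions x' lambda)]) ->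
     exists! t : nat * nat * nat,
       let: (a, b, c) := t in
       sorted_markov_triple a b c /\
       exists p1 p2 : int,
         markov_bezout a b c p1 p2 /\
         equivalent_reals (markov_irrational R a b c p2) x').
Proof.
split.
  move=> a b c p1 p2 tr bz x lambda0.
  have [k [l d]] := markov_data_triple R tr bz; have [mk bez Hk Hl Hx] := d.
  have [_ _ c0 _] := mk.
  have -> : lambda0 = sqrt_disc R c / (Posz c)%:~R by rewrite /lambda0 -[c%:R]/((Posz c)%:~R) lagrange_sqrt_disc.
  split; first exact: (good_fractions_infinite c0 Hx).
  move=> lambda; apply: (good_fractions_finite c0 Hl Hx).
  exact: cohn_min mk bez Hk Hl.
move=> x irr [lambda [lam0 lam3 fin]].
have ni := irrational_irrat irr.
have [a [b [c [p1 [p2 [k [l [X [d abc eq]]]]]]]]] :=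
  alternates_markov ni (exists_alternates ni lam0 lam3 fin).
have [tr bz XE] := markov_data_nat d; rewrite XE in eq.
have str : sorted_markov_triple (absz a) (absz b) (absz c).
  by split=> //; have [[a0 b0 c0 _] _ _ _ _] := d; lia.
exists (absz a, absz b, absz c); split; first by split=> //; exists p1, p2.
move=> [[a' b'] c'] [str' [p1' [p2' [bz' eq']]]].
exact: sorted_markov_triple_unique str str' bz bz' eq eq'.
Qed.
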